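(* Let $\mathcal{P}$ be a three-dimensional convex polytope resting with one of its faces on the plane $\mathbb{R}^2$ in a fixed initial position, and suppose that its trace $T_{\mathcal{P}}$ is dense in $\mathbb{R}^2$. Let $t$ be a reversible transition probability on pairs of faces of $\mathcal{P}$. Consider the random process, starting from the initial position, in which at each step $\mathcal{P}$ is rolled from its current supporting face $F$ to a new face $F'$ according to the transition probabilities $t(F,F')$. Then, with probability one, the set of points of the plane that coincide with a vertex of $\mathcal{P}$ at some time of the process (including time zero) is dense in $\mathbb{R}^2$.
   Context: Identify the plane $\mathbb{R}^2$ with $\mathbb{R}^2\times\{0\}\subset\mathbb{R}^3$. A three-dimensional convex polytope $\mathcal{P}$ (with labeled vertices, edges and two-dimensional faces) is placed in the closed upper half-space with one face, the supporting face, contained in the plane. A roll over an edge $e$ of the current supporting face $F$ is the rotation of $\mathcal{P}$ about the line containing $e$ until the other face $F'$ of $\mathcal{P}$ containing $e$ lies in the plane (with $\mathcal{P}$ again in the closed upper half-space); $F'$ becomes the new supporting face. The trace $T_{\mathcal{P}}$ is the set of all points of the plane that coincide with a vertex of $\mathcal{P}$ after performing some finite sequence of rolls starting from the fixed initial position. For a face $F$ of $\mathcal{P}$, $\operatorname{adj}(F)$ denotes the set of faces sharing one edge with $F$. A function $t(F,F')$ on pairs of faces of $\mathcal{P}$ is a reversible transition probability if: (1) $t(F,F')>0$ whenever $F'\in\operatorname{adj}(F)$; (2) $t(F,F')=0$ whenever $F\neq F'$ and $F'\notin\operatorname{adj}(F)$; (3) $t(F,F)=1-\sum_{F'\in\operatorname{adj}(F)}t(F,F')\geq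 0$ for each face $F$; (4) there is a function $\pi$ assigning a positive weight to each face such that $\pi(F)t(F,F')=\pi(F')t(F',F)$ for all faces $F,F'$. In the random process the sequence of supporting faces is a Markov chain with transition probabilities $t$, started at the initial supporting face: from supporting face $F$, for each $F'\in\operatorname{adj}(F)$ the polytope is rolled over the edge common to $F$ and $F'$ with probability $t(F,F')$, and with probability $t(F,F)$ it stays in its current position. *)

(* Defs.v *)
From HB Require Import structures.
From mathcomp Require Import all_boot all_order all_algebra.
From mathcomp Require Import all_classical all_reals all_analysis.
Import Order.TTheory GRing.Theory Num.Theory.
Import numFieldNormedType.Exports.

Set Implicit Arguments.
Unset Strict Implicit.
Unset Printing Implicit Defensive.

Local Open Scope classical_set_scope.
Local Open Scope ring_scope.

(* A polytope with n labelled vertices, in a given position of space, is the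
   matrix p : 'M[R]_(n, 3) whose i-th row is the current location of the vertex
   with label i. Its faces are labelled by their sets of vertices. *)
Section Polytope.
Variables (R : realType) (n : nat).
Implicit Types (p q : 'M[R]_(n, 3)) (S e : {set 'I_n}) (x c : 'rV[R]_3).

Definition dot x c : R := \sum_k x 0 k * c 0 k.

(* Convex hull of the points with label in S. *)
Definition hull p S : set 'rV[R]_3 :=
  [set x | exists w : 'rV[R]_n,
     [/\ forall i, 0 <= w 0 i, forall i, i \notin S -> w 0 i = 0,
         \sum_i w 0 i = 1 & x = w *m p]].

Definition polytope p : set 'rV[R]_3 := hull p (finset.setTfor 'I_n).

(* S is the set of all labels of points on some supporting hyperplane
   {x | dot c x = b}; the face itself is then [hull p S]. *)
Definition is_face p S : Prop :=
  exists (c : 'rV[R]_3) (b : R),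
    [/\ c != 0, forall x, polytope p x -> dot c x <= b
      & forall i, (i \in S) = (dot c (row i p) == b)].

(* Affine dimension of the points with label in S, for nonempty S. *)
Definition affdim p S : nat :=
  \rank (\sum_(i in S) \sum_(j in S) <<row j p - row i p>>)%MS.

(* The first condition says that every row is a vertex of the hull, and it
   forces distinct labels to label distinct points. *)
Definition is_polytope3 p : Prop :=
  (forall i, is_face p (finset.set1 i)) /\
  affdim p (finset.setTfor 'I_n) = 3%N.

Definition is_edge p e : Prop := is_face p e /\ affdim p e = 1%N.

Definition is_facet p S : Prop := is_face p S /\ affdim p S = 2%N.

Definition facet p : finType := {S : {set 'I_n} | `[< is_facet p S >]}.

Definition common_edge p (F F' : facet p) e : Prop :=
  [/\ is_edge p e, e \subset val F & e \subset val F'].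

Definition adj p (F F' : facet p) : bool :=
  (F != F') && `[< exists e, common_edge F F' e >].

Definition height x : R := x 0 ord_max.

Definition plane_point (y : 'rV[R]_2) : 'rV[R]_(2 + 1) := row_mx y 0.

Definition resting p S : Prop :=
  (forall x, hull p S x -> height x = 0) /\
  (forall x, polytope p x -> 0 <= height x).

Definition edge_line p e : set 'rV[R]_3 :=
  [set x | exists i j (s : R),
     [/\ i \in e, j \in e & x = row i p + s *: (row j p - row i p)]].

Definition rotation_about (L : set 'rV[R]_3) (rho : 'rV[R]_3 -> 'rV[R]_3) :
    Prop :=
  (exists (A : 'M[R]_3) (b : 'rV[R]_3),
     [/\ A *m A^T = 1%:M, \det A = 1 & forall x, rho x = x *m A + b]) /\
  (forall x, L x -> rho x = x).

Section Rolling.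
(* v is the initial position; as all positions are congruent, its faces label
   the faces in every position. *)
Variable v : 'M[R]_(n, 3).

(* The current position and the current supporting face. *)
Definition config : Type := ('M[R]_(n, 3) * facet v)%type.

Definition rolls (s s' : config) : Prop :=
  s.2 != s'.2 /\
  exists e rho,
    [/\ common_edge s.2 s'.2 e,
        rotation_about (edge_line s.1 e) rho,
        forall i, row i s'.1 = rho (row i s.1)
      & resting s'.1 (val s'.2)].

Inductive reachable (F0 : facet v) : config -> Prop :=
| reachable_init : reachable F0 (v, F0)
| reachable_roll s s' : reachable F0 s -> rolls s s' -> reachable F0 s'.

Definition has_vertex_at p (y : 'rV[R]_2) : Prop :=
  exists i, row i p = plane_point y.

Definition trace (F0 : facet v) : set 'rV[R]_2 :=
  [set y | exists s, reachable F0 s /\ has_vertex_at s.1 y].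

Definition reversible_transition (t : facet v -> facet v -> R) : Prop :=
  [/\ forall F F', adj F F' -> 0 < t F F',
      forall F F', F != F' -> ~~ adj F F' -> t F F' = 0,
      forall F, t F F = 1 - \sum_(F' | adj F F') t F F' /\ 0 <= t F F
    & exists pi : facet v -> R,
        (forall F, 0 < pi F) /\
        forall F F', pi F * t F F' = pi F' * t F' F].

End Rolling.
End Polytope.

(* The last clause is the Markov property with the conditional probability
   multiplied out. *)
Definition markov_chain (R : realType) (d : measure_display)
    (Omega : measurableType d) (P : probability Omega R) (S : finType)
    (t : S -> S -> R) (s0 : S) (X : nat -> Omega -> S) : Prop :=
  [/\ forall k s, measurable (X k @^-1` [set s]),
      P (X 0%N @^-1` [set s0]) = 1%E
    & forall k (s : nat -> S),
        P [set w | forall j, (j <= k.+1)%N -> X j w = s j] =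
        (P [set w | forall j, (j <= k)%N -> X j w = s j]
           * (t (s k) (s k.+1))%:E)%E].

(* Given the supporting faces, the positions are determined: a roll when the
   supporting face changes, and no motion when it does not. *)
Definition rolling_process (R : realType) (n : nat) (v : 'M[R]_(n, 3))
    (F0 : facet v) (t : facet v -> facet v -> R) (d : measure_display)
    (Omega : measurableType d) (P : probability Omega R)
    (Y : nat -> Omega -> config v) : Prop :=
  markov_chain P t F0 (fun k w => (Y k w).2) /\
  {ae P, forall w,
     Y 0%N w = (v, F0) /\
     forall k, Y k.+1 w = Y k w \/ rolls (Y k w) (Y k.+1 w)}.

(* Main.v *)
(* The position of the polytope is its supporting face [F] together with a
   planar motion [g], applied to a reference position with supporting face [F]; a
   roll from [F] to [K] multiplies [g] by a motion depending on [F] and [K] only.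
   So the process is a reversible walk on the product of the set of faces and the
   group of planar motions.

   Recurrence: started from the stationary law on faces, reversibility makes the
   correlations of the displacements sum up to a nonpositive number, so the mean
   square displacement after [n] steps is [O(n)]. The motions with displacement
   [O(sqrt n)] fall into [O(n)] cells of a given small size; by Cauchy-Schwarz two
   independent copies of the walk are in a common cell with probability at least
   [C / n], and by reversibility this bounds below the probability that the walk
   is near its starting position at time [2 n]. As the harmonic series diverges, a
   last visit decomposition shows that the walk almost surely comes back near its
   starting position arbitrarily late.

   Density: if some sequence of rolls from the initial position brings a vertex
   into an open set [U], the same sequence does so, with a probability bounded
   below, from all nearby positions. Hence the process almost surely brings a
   vertex into [U], and countably many sets [U] suffice. *)
Require Import Defs.
From HB Require Import structures.
From mathcomp Require Import all_boot all_order all_algebra.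
From mathcomp Require Import all_classical all_reals all_analysis.
From mathcomp Require Import ring lra.
Import Order.TTheory GRing.Theory Num.Theory.
Import numFieldNormedType.Exports.
Local Open Scope classical_set_scope.
Local Open Scope ring_scope.

Set Implicit Arguments.
Unset Strict Implicit.
Unset Printing Implicit Defensive.

(** * Reversible walks on planar motions *)

Section Motion.
Variable R : realType.

(* [(A, b)] is the planar map [x |-> x A + b]. Maps act on row vectors, so
   [mmul g h] is [g] followed by [h]. *)
Definition motion := ('M[R]_2 * 'rV[R]_2)%type.
Implicit Types g h k : motion.

Definition mmul g h : motion := (g.1 *m h.1, g.2 *m h.1 + h.2).
(** The transpose stands for the matrix inverse, so this is the inverse of [g] when [g] is
    [rigid]. *)
Definition minv g : motion := (g.1^T, - (g.2 *m g.1^T)).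
Definition mone : motion := (1%:M, 0).
Definition rigid g := g.1 *m g.1^T == 1%:M.

Lemma mmulA g h k : mmul g (mmul h k) = mmul (mmul g h) k.
Proof. by rewrite /mmul /= !mulmxA mulmxDl addrA. Qed.

Lemma mmul1m g : mmul mone g = g.
Proof. by case: g => A b; rewrite /mmul /= mul1mx mul0mx add0r. Qed.

Lemma mmulm1 g : mmul g mone = g.
Proof. by case: g => A b; rewrite /mmul /= !mulmx1 addr0. Qed.

Lemma rigid1 : rigid mone.
Proof. by rewrite /rigid /= trmx1 mulmx1. Qed.

Lemma rigidT g : rigid g -> g.1^T *m g.1 = 1%:M.
Proof. by move=> /eqP /mulmx1C. Qed.

Lemma rigidM g h : rigid g -> rigid h -> rigid (mmul g h).
Proof.
move=> /eqP pg /eqP ph; apply/eqP => /=.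
by rewrite trmx_mul mulmxA -(mulmxA _ h.1) ph mulmx1.
Qed.

Lemma rigidV g : rigid g -> rigid (minv g).
Proof. by move=> /rigidT pg; apply/eqP; rewrite /= trmxK. Qed.

Lemma mmulmV g : rigid g -> mmul g (minv g) = mone.
Proof. by move=> /eqP pg; rewrite /mmul /= pg subrr. Qed.

Lemma mmulVm g : rigid g -> mmul (minv g) g = mone.
Proof.
by move=> /rigidT pg; rewrite /mmul /= pg mulNmx -mulmxA pg mulmx1 addNr.
Qed.

Lemma minvM g h : rigid g -> rigid h ->
  minv (mmul g h) = mmul (minv h) (minv g).
Proof.
move=> pg ph; rewrite -[RHS]mmul1m -(mmulVm (rigidM pg ph)) -!mmulA.
by rewrite (mmulA h) mmulmV // mmul1m mmulmV // mmulm1.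
Qed.

Lemma minv1 : minv mone = mone.
Proof. by rewrite /minv /mone /= trmx1 mul0mx oppr0. Qed.

Definition ip (x y : 'rV[R]_2) : R := (x *m y^T) 0 0.

Lemma ipE x y : ip x y = \sum_j x 0 j * y 0 j.
Proof. by rewrite /ip mxE; apply: eq_bigr => j _; rewrite mxE. Qed.

Lemma ipC x y : ip x y = ip y x.
Proof. by rewrite !ipE; apply: eq_bigr => j _; rewrite mulrC. Qed.

Lemma ipDl x y z : ip (x + y) z = ip x z + ip y z.
Proof. by rewrite /ip mulmxDl mxE. Qed.

Lemma ipDr x y z : ip z (x + y) = ip z x + ip z y.
Proof. by rewrite !(ipC z) ipDl. Qed.

Lemma ipNr x y : ip x (- y) = - ip x y.
Proof. by rewrite /ip linearN mulmxN mxE. Qed.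

Lemma ipZl a x y : ip (a *: x) y = a * ip x y.
Proof. by rewrite /ip -scalemxAl mxE. Qed.

Lemma ip0l x : ip 0 x = 0.
Proof. by rewrite /ip mul0mx mxE. Qed.

Lemma ip_suml (I : Type) (r : seq I) (P : pred I) (f : I -> 'rV[R]_2) y :
  ip (\sum_(i <- r | P i) f i) y = \sum_(i <- r | P i) ip (f i) y.
Proof. by rewrite /ip mulmx_suml summxE. Qed.

Lemma ip_ge0 x : 0 <= ip x x.
Proof. by rewrite ipE; apply: sumr_ge0 => j _; rewrite -expr2 sqr_ge0. Qed.

Lemma ip_adj x y (A : 'M[R]_2) : ip (x *m A) y = ip x (y *m A^T).
Proof. by rewrite /ip trmx_mul trmxK mulmxA. Qed.

Lemma ip_isom x y (A : 'M[R]_2) : A *m A^T = 1%:M ->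
  ip (x *m A) (y *m A) = ip x y.
Proof. by move=> AA; rewrite ip_adj -mulmxA AA mulmx1. Qed.

End Motion.
Arguments mone {R}.

Section Walk.
Variables (R : realType) (S : finType) (t : S -> S -> R) (pi : S -> R).
Variable c : S -> S -> motion R.
Hypothesis t_ge0 : forall F K, 0 <= t F K.
Hypothesis t_sum : forall F, \sum_K t F K = 1.
Hypothesis pi_gt0 : forall F, 0 < pi F.
Hypothesis t_rev : forall F K, pi F * t F K = pi K * t K F.
Hypothesis c_rigid : forall F K, rigid (c F K).
Hypothesis c_rev : forall F K, c K F = minv (c F K).
Implicit Types (f : S -> motion R -> R) (F K : S) (g h : motion R).

(* Markov operator of the walk on pairs of a face and a motion. The motion [c F K]
   is relative to the reference position, hence it acts before [g]. *)
Definition avg f F g : R := \sum_K t F K * f K (mmul (c F K) g).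

Local Notation avgn n f := (iter n avg f).

Lemma avgn_le n f f' : (forall F g, rigid g -> f F g <= f' F g) ->
  forall F g, rigid g -> avgn n f F g <= avgn n f' F g.
Proof.
elim: n => [//|n IH] ff' F g pg /=.
by apply: ler_sum => K _; rewrite ler_wpM2l // IH // rigidM.
Qed.

Lemma avgn_eq n f f' : (forall F g, rigid g -> f F g = f' F g) ->
  forall F g, rigid g -> avgn n f F g = avgn n f' F g.
Proof.
by move=> ff' F g pg; apply/eqP; rewrite eq_le !avgn_le // => K h ph;
  rewrite ff'.
Qed.

Lemma avgn_cst n a F g : avgn n (fun _ _ => a) F g = a.
Proof.
elim: n F g => [//|n IH] F g /=.
by rewrite /avg; under eq_bigr do rewrite IH; rewrite -mulr_suml t_sum mul1r.
Qed.

Lemma avgn_ge0 n f : (forall F g, rigid g -> 0 <= f F g) ->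
  forall F g, rigid g -> 0 <= avgn n f F g.
Proof.
by move=> f0 F g pg; rewrite -(avgn_cst n 0 F g); apply: avgn_le.
Qed.

Lemma avgnD n f f' F g :
  avgn n (fun K h => f K h + f' K h) F g = avgn n f F g + avgn n f' F g.
Proof.
elim: n F g => [//|n IH] F g /=.
by rewrite /avg -big_split; apply: eq_bigr => K _; rewrite IH mulrDr.
Qed.

Lemma avgnZ n a f F g : avgn n (fun K h => a * f K h) F g = a * avgn n f F g.
Proof.
elim: n F g => [//|n IH] F g /=.
by rewrite /avg mulr_sumr; apply: eq_bigr => K _; rewrite IH mulrCA.
Qed.

Lemma avgnB n f f' F g :
  avgn n (fun K h => f K h - f' K h) F g = avgn n f F g - avgn n f' F g.
Proof.
rewrite -[X in _ + X]mulN1r -avgnZ -avgnD.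
by congr (iter n _ _ _ _); apply/funext => K; apply/funext => h; rewrite mulN1r.
Qed.

Lemma avgn_sum n (I : finType) (f : I -> S -> motion R -> R) F g :
  avgn n (fun K h => \sum_i f i K h) F g = \sum_i avgn n (f i) F g.
Proof.
elim: n F g => [//|n IH] F g /=.
rewrite /avg exchange_big /=; apply: eq_bigr => K _.
by rewrite IH mulr_sumr.
Qed.

Lemma avgnM n f F g h :
  avgn n f F (mmul g h) = avgn n (fun K k => f K (mmul k h)) F g.
Proof.
elim: n F g => [//|n IH] F g /=.
by apply: eq_bigr => K _; rewrite mmulA IH.
Qed.

Lemma avgn_shift n f F g :
  avgn n f F g = avgn n (fun K k => f K (mmul k g)) F mone.
Proof. by rewrite -avgnM mmul1m. Qed.

Lemma avgnS n f F : avgn n.+1 f F mone = \sum_K t F K * avgn n f K (c F K).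
Proof. by rewrite /= /avg; apply: eq_bigr => K _; rewrite mmulm1. Qed.

(** * Diffusive bound on the mean square displacement *)

Definition transport (x : S -> 'rV[R]_2) F : 'rV[R]_2 :=
  \sum_K t F K *: (x K *m (c F K).1).

Definition pair_pi (x y : S -> 'rV[R]_2) : R := \sum_F pi F * ip (x F) (y F).

Lemma sum_rev (f : S -> S -> R) :
  \sum_F \sum_K pi F * t F K * f F K = \sum_F \sum_K pi F * t F K * f K F.
Proof.
rewrite exchange_big /=; apply: eq_bigr => F _; apply: eq_bigr => K _.
by rewrite t_rev.
Qed.

Lemma pi_stationary (a : S -> R) :
  \sum_F \sum_K pi F * t F K * a K = \sum_F pi F * a F.
Proof.
rewrite sum_rev; apply: eq_bigr => F _.
by rewrite -mulr_suml -mulr_sumr t_sum mulr1.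
Qed.

Lemma pair_transportE x y : pair_pi (transport x) y =
  \sum_F \sum_K pi F * t F K * ip (x K *m (c F K).1) (y F).
Proof.
apply: eq_bigr => F _; rewrite ip_suml mulr_sumr.
by apply: eq_bigr => K _; rewrite ipZl mulrA.
Qed.

Lemma pair_piC x y : pair_pi x y = pair_pi y x.
Proof. by apply: eq_bigr => F _; rewrite ipC. Qed.

Lemma pair_piDl x y z :
  pair_pi (fun F => x F + y F) z = pair_pi x z + pair_pi y z.
Proof. by rewrite -big_split; apply: eq_bigr => F _; rewrite ipDl mulrDr. Qed.

Lemma pair_pi_ge0 x : 0 <= pair_pi x x.
Proof. by apply: sumr_ge0 => F _; rewrite mulr_ge0 ?ip_ge0 // ltW. Qed.

(** [transport] is the Markov operator on vector fields over the faces, twisted by the linear parts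
    of [c]. Detailed balance exchanges [F] and [K], and [c_rev] transposes the linear part. *)
Lemma transport_sym x y : pair_pi (transport x) y = pair_pi x (transport y).
Proof.
rewrite pair_transportE (pair_piC x) pair_transportE sum_rev.
apply: eq_bigr => F _; apply: eq_bigr => K _.
by rewrite c_rev /= ip_adj trmxK ipC.
Qed.

(** Sum the squared norms of [x F + x K *m (c F K).1] with the weights [pi F * t F K]. The two
    square terms agree by stationarity, so half of this sum is the claimed quantity. *)
Lemma pair_transport_ge x : 0 <= pair_pi x x + pair_pi (transport x) x.
Proof.
have : 0 <= \sum_F \sum_K pi F * t F K *
    ip (x F + x K *m (c F K).1) (x F + x K *m (c F K).1).
  apply: sumr_ge0 => F _; apply: sumr_ge0 => K _.
  by rewrite !mulr_ge0 ?ip_ge0 // ltW.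
have -> : \sum_F \sum_K pi F * t F K *
    ip (x F + x K *m (c F K).1) (x F + x K *m (c F K).1) =
  \sum_F \sum_K pi F * t F K * ip (x F) (x F) +
  \sum_F \sum_K pi F * t F K * ip (x K) (x K) +
  2 * \sum_F \sum_K pi F * t F K * ip (x K *m (c F K).1) (x F).
  rewrite mulr_sumr -!big_split; apply: eq_bigr => F _ /=.
  rewrite mulr_sumr -!big_split; apply: eq_bigr => K _ /=.
  rewrite !ipDl !ipDr ip_isom ?(eqP (c_rigid _ _)) //.
  by rewrite (ipC (x F) (x K *m _)); ring.
rewrite -pair_transportE (pi_stationary (fun K => ip (x K) (x K))).
rewrite (sum_rev (fun F _ => ip (x F) (x F))).
rewrite (pi_stationary (fun K => ip (x K) (x K))) -/(pair_pi x x); lra.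
Qed.

(** The partial sum [x + T x + ... + T^(n-1) x] with [T = transport]; for [x = drift1] it is the
    expected displacement after [n] steps. *)
Fixpoint drift (x : S -> 'rV[R]_2) n : S -> 'rV[R]_2 :=
  if n is m.+1 then fun F => x F + transport (drift x m) F else fun=> 0.

Lemma transportD x y : transport (fun F => x F + y F) =
  (fun F => transport x F + transport y F).
Proof.
apply/funext => F; rewrite /transport -big_split; apply: eq_bigr => K _.
by rewrite mulmxDl scalerDr.
Qed.

Lemma transport_drift x n : transport (drift x n) = drift (transport x) n.
Proof.
elim: n => [|n IH] /=.
  by apply/funext => F; rewrite /transport big1 // => K _; rewrite mul0mx scaler0.
by rewrite transportD IH.
Qed.

(* Two steps at a time, [drift] contributes [<x, (1 + T) x>], which is
   nonnegative because the self-adjoint contraction [T] is at least [-1]. *)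
Lemma pair_drift_ge0 n x : 0 <= pair_pi (drift x n) x.
Proof.
elim/ltn_ind: n x => -[|[|n]] IH x /=.
- by rewrite /pair_pi big1 // => F _; rewrite ip0l mulr0.
- have -> : (fun F => x F + transport (fun=> 0) F) = x.
    apply/funext => F; rewrite /transport big1 ?addr0 // => K _.
    by rewrite mul0mx scaler0.
  exact: pair_pi_ge0.
rewrite pair_piDl transportD pair_piDl addrA addr_ge0 ?pair_transport_ge //.
by rewrite transport_sym transport_drift IH.
Qed.

Definition drift1 F : 'rV[R]_2 := \sum_K t F K *: (c F K).2.

Fixpoint moment n F : R :=
  if n is m.+1 then \sum_K t F K *
    (moment m K + 2 * ip (drift drift1 m K *m (c F K).1) (c F K).2
     + ip (c F K).2 (c F K).2)
  else 0.

(** Starting from [g] turns the displacement by the linear part of [g] and adds [g.2]. Expanding the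
    square, the cross term sees only the expected displacement; for [g = mone] only [moment]
    remains. *)
Lemma avgn_moment n F g : rigid g ->
  avgn n (fun _ h => ip h.2 h.2) F g =
  moment n F + 2 * ip (drift drift1 n F *m g.1) g.2 + ip g.2 g.2.
Proof.
elim: n F g => [|n IH] F g pg /=; first by rewrite mul0mx ip0l; ring.
rewrite /avg.
have -> : ip g.2 g.2 = \sum_K t F K * ip g.2 g.2.
  by rewrite -mulr_suml t_sum mul1r.
have -> : ip ((drift1 F + transport (drift drift1 n) F) *m g.1) g.2 =
  \sum_K t F K * ip ((drift drift1 n K *m (c F K).1 + (c F K).2) *m g.1) g.2.
  rewrite /drift1 /transport -big_split mulmx_suml ip_suml.
  by apply: eq_bigr => K _ /=; rewrite -scalerDr -scalemxAl ipZl addrC.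
rewrite mulr_sumr -!big_split /=; apply: eq_bigr => K _.
rewrite IH ?rigidM //= (mulmxA _ _ g.1) ipDr ip_isom ?(eqP pg) //.
rewrite mulmxDl !ipDl !ipDr ip_isom ?(eqP pg) // (ipC g.2).
ring.
Qed.

Definition step_var : R := \sum_F \sum_K pi F * t F K * ip (c F K).2 (c F K).2.

(** One more step adds [step_var] and a cross term; reversing that step makes the cross term [-2]
    times the pairing of [drift drift1 n] with [drift1], which is nonpositive by
    [pair_drift_ge0]. *)
Lemma sum_moment n : \sum_F pi F * moment n F <= n%:R * step_var.
Proof.
elim: n => [|n IH]; first by rewrite mul0r big1 // => F _; rewrite mulr0.
have -> : \sum_F pi F * moment n.+1 F = \sum_F pi F * moment n F + step_var
    - 2 * pair_pi (drift drift1 n) drift1.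
  rewrite -(pi_stationary (moment n)) /step_var.
  (* The reverse of a step [(A, b)] has displacement [- (b *m A^T)], whence the sign. *)
  have -> : pair_pi (drift drift1 n) drift1 =
    - \sum_F \sum_K pi F * t F K * ip (drift drift1 n K *m (c F K).1) (c F K).2.
    rewrite sum_rev -sumrN; apply: eq_bigr => F _.
    rewrite ipC ip_suml mulr_sumr -sumrN; apply: eq_bigr => K _.
    rewrite ipZl mulrA -mulrN; congr (_ * _).
    by rewrite ip_adj (c_rev F K) /= trmxK mulNmx -mulmxA (rigidT (c_rigid _ _))
      mulmx1 ipNr opprK ipC.
  rewrite mulrN opprK mulr_sumr -!big_split; apply: eq_bigr => F _ /=.
  rewrite !mulr_sumr -!big_split; apply: eq_bigr => K _ /=; ring.
rewrite mulrDl mul1r -natr1 in IH *.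
have := pair_drift_ge0 n drift1; lra.
Qed.

(** * Reversal of time *)

Definition hit F0 (f : motion R -> R) : S -> motion R -> R :=
  fun K g => (K == F0)%:R * f g.

(** The iterate of [avg] unfolds at the first step of the path; this peels off the last one, whose
    motion multiplies on the left. *)
Lemma avgn_hitS n F F0 (f : motion R -> R) :
  avgn n.+1 (hit F0 f) F mone =
  \sum_K t K F0 * avgn n (hit K (fun g => f (mmul (c K F0) g))) F mone.
Proof.
rewrite iterSr.
under [RHS]eq_bigr do rewrite -avgnZ.
rewrite -avgn_sum; apply: avgn_eq (rigid1 _) => K g _.
rewrite /avg (bigD1 F0) //= [X in _ + X]big1 => [|L /negPf LF]; last first.
  by rewrite /hit LF mul0r mulr0.
rewrite (bigD1 K) //= [X in _ = _ + X]big1 => [|L]; last first.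
  by rewrite eq_sym /hit => /negPf ->; rewrite mul0r mulr0.
by rewrite /hit !eqxx !addr0.
Qed.

(** Read each path backwards: detailed balance moves the weight from [F] to [F0], and the inverse
    steps in reverse order multiply to the inverse motion. *)
Lemma avgn_rev n F F0 (f : motion R -> R) :
  pi F * avgn n (hit F0 f) F mone =
  pi F0 * avgn n (hit F (fun g => f (minv g))) F0 mone.
Proof.
elim: n F F0 f => [|n IH] F F0 f.
  by rewrite /= /hit (eq_sym F0) minv1; case: eqP => [->//|];
    rewrite !mul0r !mulr0.
rewrite avgnS avgn_hitS !mulr_sumr; apply: eq_bigr => K _.
rewrite mulrA t_rev mulrAC [in RHS]mulrCA mulrC; congr (_ * _).
rewrite avgn_shift.
rewrite [LHS](_ : _ = pi K * avgn n (hit F0 (fun g => f (mmul g (c F K)))) K mone) //.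
rewrite IH; congr (_ * _); apply: avgn_eq (rigid1 _) => L g pg.
by rewrite /hit minvM // -c_rev.
Qed.


End Walk.

(** * Recurrence *)

Section Near.
Variable R : realType.
Implicit Types g h k : motion R.

Definition near_id (e : R) g : bool :=
  [forall i, forall j, `|g.1 i j - (i == j)%:R| <= e] &&
  [forall j, `|g.2 0 j| <= e].

Lemma near_idP e g : reflect
  ((forall i j, `|g.1 i j - (i == j)%:R| <= e) /\ forall j, `|g.2 0 j| <= e)
  (near_id e g).
Proof.
apply: (iffP andP) => -[gA gb]; split.
- by move=> i j; exact: (forallP (forallP gA i) j).
- exact/forallP.
- by apply/forallP => i; apply/forallP.
- exact/forallP.
Qed.

Lemma rigid_entry g i j : rigid g -> `|g.1 i j| <= 1.
Proof.
move=> /eqP /(congr1 (fun A : 'M[R]_2 => A i i)); rewrite !mxE eqxx mulr1n => gg.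
rewrite -(@ler_pXn2r _ 2) ?nnegrE // expr1n real_normK ?num_real // -gg.
rewrite (bigD1 j) //= mxE -expr2 lerDl sumr_ge0 // => l _.
by rewrite mxE -expr2 sqr_ge0.
Qed.

Lemma mulmx_rigid_le e h m (A : 'M[R]_(m, 2)) : rigid h ->
  (forall i j, `|A i j| <= e) -> forall i j, `|(A *m h.1^T) i j| <= 2 * e.
Proof.
move=> ph Ae i j; rewrite mxE (le_trans (ler_norm_sum _ _ _)) //.
rewrite mulr_natl -[X in e *+ X](card_ord 2) -sumr_const ler_sum // => l _.
rewrite normrM mxE -[e]mulr1 ler_pM // ?rigid_entry //.
Qed.

Lemma near_id_div e h k : rigid h ->
  (forall i j, `|k.1 i j - h.1 i j| <= e) ->
  (forall j, `|k.2 0 j - h.2 0 j| <= e) -> near_id (2 * e) (mmul k (minv h)).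
Proof.
move=> ph kA kb; apply/near_idP; split=> [i j|j] /=.
  have -> : (i == j)%:R = (h.1 *m h.1^T) i j by rewrite (eqP ph) mxE.
  have -> : (k.1 *m h.1^T) i j - (h.1 *m h.1^T) i j = ((k.1 - h.1) *m h.1^T) i j.
    by rewrite mulmxBl !mxE.
  by apply: mulmx_rigid_le => // i' j'; rewrite !mxE.
rewrite -mulmxBl; apply: mulmx_rigid_le => // i j'.
by rewrite ord1 !mxE.
Qed.

(** [g] is [mmul g h] times the inverse of [h]. These two motions differ entrywise by at most
    [2 * e], and [near_id_div] doubles this. *)
Lemma near_id_cancel e g h : rigid h -> near_id e h -> near_id e (mmul g h) ->
  near_id (4 * e) g.
Proof.
move=> ph /near_idP[hA hb] /near_idP[ghA ghb].
rewrite -[g]mmulm1 -(mmulmV ph) mmulA.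
have -> : 4 * e = 2 * (2 * e) by ring.
apply: near_id_div => // [i j|j].
  rewrite [X in `|X|](_ : _ = (mmul g h).1 i j - (i == j)%:R
      - (h.1 i j - (i == j)%:R)); last by ring.
  by rewrite (le_trans (ler_normB _ _)) // mulr_natl mulr2n lerD.
by rewrite (le_trans (ler_normB _ _)) // mulr_natl mulr2n lerD.
Qed.

Lemma near_id1 e : 0 <= e -> near_id e mone.
Proof.
by move=> e0; apply/near_idP; split=> *; rewrite !mxE ?subrr normr0.
Qed.

(** Index of the interval of length [e] containing [x] in a subdivision of [[-r, r]]. Under the
    bounds assumed in [bin_close], [inord] does not meet its default value. *)
Definition bin L (r e x : R) : 'I_L.+1 := inord (Num.truncn ((x + r) / e)).

Lemma bin_close r e x y L : 0 < e -> `|x| <= r -> `|y| <= r ->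
  (Num.truncn (2 * r / e) <= L)%N -> bin L r e x = bin L r e y -> `|x - y| <= e.
Proof.
move=> e0 xr yr rL /(congr1 (@nat_of_ord _)).
have bnd z : `|z| <= r -> 0 <= (z + r) / e /\ (Num.truncn ((z + r) / e) < L.+1)%N.
  rewrite ler_norml => /andP[z1 z2]; split.
    by rewrite divr_ge0 ?(ltW e0) //; lra.
  rewrite ltnS (leq_trans _ rL) // le_truncn // ler_pM2r ?invr_gt0 //; lra.
have [x0 xL] := bnd x xr; have [y0 yL] := bnd y yr.
rewrite !inordK // => exy.
have := truncn_itv x0; have := truncn_itv y0; rewrite exy -natr1.
set u : R := _%:R => /andP[a1 a2] /andP[b1 b2].
have : `|(x + r) / e - (y + r) / e| <= 1 by rewrite ler_norml; lra.
rewrite -mulrBl opprD addrACA subrr addr0 normrM [`|e^-1|]gtr0_norm ?invr_gt0 //.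
by rewrite ler_pdivrMr // mul1r.
Qed.

End Near.

(** * Return probabilities and survival *)

Section Recurrence.
Variables (R : realType) (S : finType) (t : S -> S -> R) (pi : S -> R).
Variable c : S -> S -> motion R.
Hypothesis t_ge0 : forall F K, 0 <= t F K.
Hypothesis t_sum : forall F, \sum_K t F K = 1.
Hypothesis pi_gt0 : forall F, 0 < pi F.
Hypothesis t_rev : forall F K, pi F * t F K = pi K * t K F.
Hypothesis c_rigid : forall F K, rigid (c F K).
Hypothesis c_rev : forall F K, c K F = minv (c F K).
Variable F0 : S.
Implicit Types (f : S -> motion R -> R) (V W : S -> motion R -> bool).
Implicit Types (F K : S) (g h : motion R).

Local Notation avgn n f := (iter n (avg t c) f).
Let avgn_le := avgn_le t_ge0 c_rigid.
Let avgn_rev := avgn_rev t_ge0 t_rev c_rigid c_rev.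

Definition at_start e K g : bool := (K == F0) && near_id e g.

Lemma avgn_hit_sum n f g : avgn n f F0 g = \sum_F avgn n (hit F (f F)) F0 g.
Proof.
rewrite -avgn_sum; congr (iter n _ _ _ _); apply/funext => K; apply/funext => k.
rewrite (bigD1 K) //= big1 => [|F]; first by rewrite /hit eqxx mul1r addr0.
by rewrite /hit eq_sym => /negPf ->; rewrite mul0r.
Qed.

Lemma hit_mass n : \sum_F pi F * avgn n (hit F0 (fun=> 1)) F mone = pi F0.
Proof.
under eq_bigr do rewrite avgn_rev.
rewrite -mulr_sumr -(avgn_hit_sum n (fun _ _ => 1)).
by rewrite (avgn_cst c t_sum) mulr1.
Qed.

(* Reversibility turns the return probability after [2 n] steps into the sum
   over [F] of the probability that two independent copies of the walk from [F]
   are close to each other after [n] steps. *)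
Lemma return_cells n (e : R) (I : finType) (cell : motion R -> I)
    (B : pred (motion R)) :
  (forall h k, rigid h -> rigid k -> B h -> B k -> cell h = cell k ->
    near_id e (mmul k (minv h))) ->
  (\sum_F pi F * avgn n (hit F0 (fun g => (B g)%:R)) F mone) ^+ 2 <=
  #|I|%:R * (\sum_F pi F) *
    (pi F0 * avgn (n + n) (fun K g => (at_start e K g)%:R) F0 mone).
Proof.
move=> cellP; set ret := (fun K g => (at_start e K g)%:R).
pose ind i g : R := (B g && (cell g == i))%:R.
pose m F i := avgn n (hit F0 (ind i)) F mone.
have m_ge0 F i : 0 <= m F i.
  by apply: (avgn_ge0 t_ge0 t_sum c_rigid) (rigid1 R) => K g _; rewrite mulr_ge0.
have ind_sum g (a : I -> R) : \sum_i a i * ind i g = (B g)%:R * a (cell g).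
  rewrite (bigD1 (cell g)) //= big1 => [|i]; last first.
    by rewrite /ind eq_sym => /negPf ->; rewrite andbF mulr0.
  by rewrite /ind eqxx andbT addr0 mulrC.
have m_sum F : avgn n (hit F0 (fun g => (B g)%:R)) F mone = \sum_i m F i.
  rewrite -avgn_sum; congr (iter n _ _ _ _); apply/funext => K; apply/funext => g.
  rewrite /hit -mulr_sumr; congr (_ * _).
  by have := ind_sum g (fun=> 1); rewrite mulr1 => <-; under eq_bigr do rewrite mul1r.
(* Split the path of length [n + n] at its middle face [F] and reverse the first half: both halves
   now start from [F]. If they end at [g] and [h] in a common cell, the whole path ends at
   [mmul h (minv g)], near the identity. *)
have sq_le : \sum_F pi F * \sum_i m F i ^+ 2 <= pi F0 * avgn (n + n) ret F0 mone.
  rewrite iterD avgn_hit_sum mulr_sumr; apply: ler_sum => F _.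
  rewrite avgn_rev ler_pM2l //.
  have -> : \sum_i m F i ^+ 2 =
      avgn n (fun K g => \sum_i m F i * hit F0 (ind i) K g) F mone.
    by rewrite avgn_sum; apply: eq_bigr => i _; rewrite avgnZ.
  apply: avgn_le (rigid1 R) => K g pg; rewrite /hit.
  under eq_bigr do rewrite mulrCA.
  rewrite -mulr_sumr ler_wpM2l // ind_sum.
  have ret_ge0 : 0 <= avgn n ret F (minv g).
    by apply: (avgn_ge0 t_ge0 t_sum c_rigid) (rigidV pg) => L h _; rewrite /ret.
  case: (boolP (B g)) => [Bg|]; last by rewrite mul0r.
  rewrite mul1r avgn_shift; apply: avgn_le (rigid1 R) => L h ph.
  rewrite /hit /ind /ret /at_start.
  case: eqP; rewrite ?mul0r // mul1r ler_nat; case: andP => // -[Bh /eqP hg] _.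
  by rewrite cellP.
have A_gt0 : 0 < #|I|%:R * (\sum_F pi F).
  rewrite mulr_gt0 //.
    by rewrite ltr0n; apply/card_gt0P; exists (cell mone).
  by rewrite (bigD1 F0) //= ltr_pwDl // sumr_ge0 // => F _; rewrite ltW.
set A := _ * _ in A_gt0 *.
under eq_bigr do rewrite m_sum.
(* Cauchy-Schwarz, as nonnegativity of the weighted sum of [(m F i - x) ^+ 2] at the minimizing
   [x]. *)
set b := \sum_F _; pose x := b / A.
suff : 0 <= (\sum_F pi F * \sum_i m F i ^+ 2) - 2 * x * b + x ^+ 2 * A.
  rewrite -subr_ge0 in sq_le; move=> H; rewrite -subr_ge0.
  have bE : b = x * A by rewrite /x divfK // gt_eqF.
  have -> : b ^+ 2 = A * (2 * x * b - x ^+ 2 * A) by rewrite bE; ring.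
  rewrite -mulrBr mulr_ge0 ?(ltW A_gt0) //; lra.
have -> : (\sum_F pi F * \sum_i m F i ^+ 2) - 2 * x * b + x ^+ 2 * A =
    \sum_F pi F * \sum_i (m F i - x) ^+ 2.
  have sq F : pi F * \sum_i (m F i - x) ^+ 2 = pi F * \sum_i m F i ^+ 2
      - 2 * x * (pi F * \sum_i m F i) + x ^+ 2 * #|I|%:R * pi F.
    have -> : \sum_i (m F i - x) ^+ 2 =
        \sum_i m F i ^+ 2 - 2 * x * \sum_i m F i + x ^+ 2 * #|I|%:R.
      rewrite mulr_natr -sumr_const mulr_sumr -sumrN -!big_split.
      by apply: eq_bigr => i _ /=; ring.
    ring.
  under [RHS]eq_bigr do rewrite sq.
  by rewrite !big_split /= sumrN -!mulr_sumr /A mulrA.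
apply: sumr_ge0 => F _; rewrite mulr_ge0 ?(ltW (pi_gt0 F)) //.
by apply: sumr_ge0 => i _; rewrite sqr_ge0.
Qed.

(** Chebyshev's inequality: the mass outside the ball is at most the second moment over [r], and
    [hit_mass] gives the total mass. *)
Lemma ball_mass n (r : R) : 0 < r ->
  pi F0 - n%:R * step_var t pi c / r <=
  \sum_F pi F * avgn n (hit F0 (fun g => (ip g.2 g.2 <= r)%R%:R)) F mone.
Proof.
move=> r0.
have mom : (\sum_F pi F * moment t c n F) / r <= n%:R * step_var t pi c / r.
  by rewrite ler_pM2r ?invr_gt0 // (sum_moment t_ge0 t_sum pi_gt0 t_rev).
rewrite -[X in X - _](hit_mass n).
apply: (@le_trans _ _ (\sum_F pi F * avgn n (hit F0 (fun=> 1)) F mone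
   - (\sum_F pi F * moment t c n F) / r)); first by rewrite lerD2l lerN2.
rewrite mulr_suml -sumrN -big_split; apply: ler_sum => F _ /=.
rewrite -mulrA -mulrBr ler_pM2l //.
have -> : moment t c n F = avgn n (fun _ h => ip h.2 h.2) F mone.
  by rewrite (avgn_moment t_sum c_rigid) ?rigid1 //= (ipC _ 0) !ip0l; ring.
rewrite mulrC -avgnZ -avgnB; apply: avgn_le (rigid1 R) => K g _.
rewrite /hit; case: (boolP (ip g.2 g.2 <= r)) => [_|].
  by rewrite gerBl mulr_ge0 ?ip_ge0 // invr_ge0 ltW.
rewrite mulr0 -ltNge mulr1 => /ltW rg.
have : 1 <= r^-1 * ip g.2 g.2 by rewrite mulrC ler_pdivlMr // mul1r.
by case: eqP => _; rewrite ?mulr1n ?mulr0n; lra.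
Qed.

(** Apply [return_cells] to a ball whose squared radius is proportional to [n.+1]. The linear parts
    need a bounded number of cells and the translations [O(n)]. *)
Lemma return_lb (e : R) : 0 < e -> exists2 C, 0 < C & forall n,
  C / n.+1%:R <= avgn (n + n) (fun K g => (at_start e K g)%:R) F0 mone.
Proof.
move=> e0; pose d := e / 2; have d0 : 0 < d by rewrite divr_gt0.
have V0 : 0 <= step_var t pi c.
  apply: sumr_ge0 => F _; apply: sumr_ge0 => K _.
  by rewrite !mulr_ge0 ?ip_ge0 // ltW.
(* Adding 1 keeps [V] positive even if no step displaces the origin. *)
pose V := step_var t pi c + 1; have V_gt0 : 0 < V by rewrite /V; lra.
have p0 := pi_gt0 F0.
(* With this [rho], [ball_mass] loses at most half of the mass [pi F0]. *)
pose rho := 2 * V / pi F0; have rho0 : 0 < rho by rewrite divr_gt0 // mulr_gt0.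
pose K1 := Num.truncn (2 * 1 / d).
pose T := \sum_F pi F.
have T0 : 0 < T.
  by rewrite /T (bigD1 F0) //= ltr_pwDl // sumr_ge0 // => F _; rewrite ltW.
(* [C1 * n.+1] bounds the number of cells: four matrix entries with [K1.+1] bins each, and two
   coordinates with [L1.+1] bins, where [L1.+1 ^ 2] is at most [2 * (L1 ^ 2 + 1)]. *)
pose C1 : R := (K1.+1 ^ 4)%:R * (2 * (4 * rho / d ^+ 2 + 1)).
have C10 : 0 < C1.
  have q0 : 0 < 4 * rho / d ^+ 2.
    by apply: divr_gt0; [exact: mulr_gt0|exact: exprn_gt0].
  apply: mulr_gt0; first by rewrite ltr0n expn_gt0.
  by apply: mulr_gt0 => //; apply: addr_gt0.
exists ((pi F0 / 2) ^+ 2 / (C1 * T * pi F0)).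
  by apply: divr_gt0; [exact/exprn_gt0/divr_gt0|do 2?apply: mulr_gt0].
move=> n; pose r := rho * n.+1%:R; have r0 : 0 < r by rewrite mulr_gt0.
pose s : R := Num.sqrt r; pose L1 := Num.truncn (2 * s / d).
pose I := ({ffun 'I_2 * 'I_2 -> 'I_K1.+1} * {ffun 'I_2 -> 'I_L1.+1})%type.
pose cell (g : motion R) : I :=
  ([ffun ij => bin K1 1 d (g.1 ij.1 ij.2)], [ffun j => bin L1 s d (g.2 0 j)]).
have cellP (h k : motion R) : rigid h -> rigid k -> ip h.2 h.2 <= r ->
    ip k.2 k.2 <= r -> cell h = cell k -> near_id e (mmul k (minv h)).
  move=> ph pk Bh Bk [/ffunP cA /ffunP cb].
  have -> : e = 2 * d by rewrite /d; field.
  have Bs (g : motion R) j : ip g.2 g.2 <= r -> `|g.2 0 j| <= s.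
    move=> gr; rewrite -sqrtr_sqr ler_sqrt ?(ltW r0) // (le_trans _ gr) //.
    rewrite ipE (bigD1 j) //= -expr2 lerDl sumr_ge0 // => l _.
    by rewrite -expr2 sqr_ge0.
  apply: near_id_div => // [i j|j].
    rewrite distrC; apply: (@bin_close _ 1 d _ _ K1) => //; try exact: rigid_entry.
    by have := cA (i, j); rewrite !ffunE.
  rewrite distrC; apply: (@bin_close _ s d _ _ L1) => //; try exact: Bs.
  by have := cb j; rewrite !ffunE.
have := @return_cells n e I cell (fun g => ip g.2 g.2 <= r)%R cellP.
have cardI : #|{: I}|%:R <= C1 * n.+1%:R.
  rewrite card_prod !card_ffun card_prod !card_ord natrM /C1.
  rewrite -mulrA ler_pM2l; last first.
    by rewrite ltr0n expn_gt0.
  apply: (@le_trans _ _ (2 * (L1%:R ^+ 2 + 1))).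
    rewrite natrX -natr1; have := sqr_ge0 (L1%:R - 1 : R); lra.
  rewrite -mulrA ler_pM2l // mulrDl mul1r lerD //; last by rewrite ler1n.
  have sd0 : 0 <= 2 * s / d.
    by rewrite divr_ge0 ?(ltW d0) // mulr_ge0 ?sqrtr_ge0.
  apply: (@le_trans _ _ ((2 * s / d) ^+ 2)).
    by rewrite ler_pXn2r ?nnegrE ?ler0n // truncn_le.
  rewrite expr_div_n exprMn sqr_sqrtr ?(ltW r0) // /r.
  by rewrite le_eqVlt; apply/orP; left; apply/eqP; field; rewrite gt_eqF.
set p := avgn (n + n) _ F0 mone; set b := \sum_F _ => bp.
have p_ge0 : 0 <= p.
  by apply: (avgn_ge0 t_ge0 t_sum c_rigid) (rigid1 R) => L h _.
have b_ge : pi F0 / 2 <= b.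
  apply: le_trans (ball_mass n r0).
  suff : n%:R * step_var t pi c / r <= pi F0 / 2 by lra.
  rewrite ler_pdivrMr //.
  have -> : pi F0 / 2 * r = n.+1%:R * V.
    by rewrite /r /rho; field; rewrite gt_eqF.
  by apply: ler_pM; rewrite ?ler_nat // /V; lra.
rewrite ler_pdivrMr // ler_pdivrMr; last first.
  by apply: mulr_gt0 => //; apply: mulr_gt0.
apply: (@le_trans _ _ (b ^+ 2)).
  by rewrite ler_pXn2r ?nnegrE //; lra.
apply: (le_trans bp).
rewrite [leRHS](_ : _ = C1 * n.+1%:R * T * (pi F0 * p)); last by ring.
by rewrite ler_wpM2r ?mulr_ge0 ?(ltW p0) // ler_pM2r.
Qed.

(** By [return_lb] the terms at even times dominate a multiple of the harmonic series; those at odd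
    times are nonnegative and are dropped. *)
Lemma return_diverges (e M : R) : 0 < e -> exists N,
  M <= \sum_(n < N) avgn n (fun K g => (at_start e K g)%:R) F0 mone.
Proof.
move=> e0; have [C C0 HC] := return_lb e0.
set f := (fun K g => (at_start e K g)%:R) in HC *.
have f_ge0 n : 0 <= avgn n f F0 mone.
  by apply: (avgn_ge0 t_ge0 t_sum c_rigid) (rigid1 R) => L h _.
apply/not_existsP => H; apply: (@dvg_harmonic R).
apply: nondecreasing_is_cvgn.
  apply/nondecreasing_seqP => n; rewrite !seriesEord /= big_ord_recr /= lerDl.
  by rewrite invr_ge0.
exists (M / C) => _ [N _ <-]; rewrite ler_pdivlMr // seriesEord /=.
have /negP := H N.*2; rewrite -ltNge => /ltW; apply: le_trans.
rewrite mulr_suml; elim: N => [|N IH]; first by rewrite !big_ord0.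
rewrite doubleS !big_ord_recr /= -addrA lerD // mulrC (le_trans (HC N)) //.
by rewrite addnn lerDl (f_ge0 N.*2.+1).
Qed.

(** The operator of the walk killed in [V]. *)
Definition stay (V : S -> motion R -> bool) f F g : R :=
  if V F g then 0 else avg t c f F g.

(* Probability that the walk avoids [V] at the times [0, ..., N - 1]. *)
Definition survive V N := iter N (stay V) (fun _ _ => 1).

Lemma surviveS V N F g :
  survive V N.+1 F g = if V F g then 0 else avg t c (survive V N) F g.
Proof. by []. Qed.

Lemma iter_stay_le V n f f' F g :
  (forall F g, rigid g -> f F g <= f' F g) -> rigid g ->
  iter n (stay V) f F g <= iter n (stay V) f' F g.
Proof.
move=> ff'; elim: n F g => [|n IH] F g pg /=; first exact: ff'.
rewrite /stay; case: ifP => // _; apply: ler_sum => K _.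
by rewrite ler_wpM2l // IH // rigidM.
Qed.

Lemma iter_stay_ge0 V n f F g : (forall F g, rigid g -> 0 <= f F g) ->
  rigid g -> 0 <= iter n (stay V) f F g.
Proof.
move=> f0; elim: n F g => [|n IH] F g pg /=; first exact: f0.
rewrite /stay; case: ifP => // _; apply: sumr_ge0 => K _.
by rewrite mulr_ge0 // IH // rigidM.
Qed.

Lemma iter_stay_avgn V n f F g : (forall F g, rigid g -> 0 <= f F g) ->
  rigid g -> iter n (stay V) f F g <= avgn n f F g.
Proof.
move=> f0; elim: n F g => [//|n IH] F g pg /=.
apply: (@le_trans _ _ (avg t c (iter n (stay V) f) F g)).
  rewrite /stay; case: ifP => // _; apply: sumr_ge0 => K _.
  by rewrite mulr_ge0 // iter_stay_ge0 // rigidM.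
by apply: ler_sum => K _; rewrite ler_wpM2l // IH // rigidM.
Qed.

Lemma survive_ge0 V N F g : rigid g -> 0 <= survive V N F g.
Proof. exact: iter_stay_ge0. Qed.

Lemma survive_le1 V N F g : rigid g -> survive V N F g <= 1.
Proof.
move=> pg; rewrite -(avgn_cst c t_sum N 1 F g).
exact: iter_stay_avgn.
Qed.

Lemma survive_anti V m n F g : rigid g ->
  (m <= n)%N -> survive V n F g <= survive V m F g.
Proof.
move=> pg /subnKC <-; rewrite /survive iterD; apply: iter_stay_le => // K h.
exact: survive_le1.
Qed.

(** A shift by [k] is made of [k] shifts by one, each telescoping to a difference of two values in
    [[0, 1]]. *)
Lemma sum_shift_le (b : nat -> R) M k : (forall n, 0 <= b n <= 1) ->
  \sum_(n < M) (b (n + k)%N - b n) <= k%:R.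
Proof.
move=> b01; elim: k => [|k IH].
  by rewrite big1 // => n _; rewrite addn0 subrr.
have -> : \sum_(n < M) (b (n + k.+1)%N - b n) =
    \sum_(n < M) (b (n.+1 + k)%N - b (n + k)%N) + \sum_(n < M) (b (n + k)%N - b n).
  by rewrite -big_split; apply: eq_bigr => n _ /=; rewrite addSnnS; ring.
rewrite -natr1 addrC lerD //.
rewrite -(big_mkord xpredT (fun n => b (n.+1 + k)%N - b (n + k)%N)).
rewrite (telescope_sumr (fun n => b (n + k)%N)) //.
have /andP[_ h1] := b01 (M + k)%N; have /andP[h2 _] := b01 (0 + k)%N; lra.
Qed.

(* The [n]-th summand is the probability of a visit to [V] at time [n] that is
   followed by none from time [n + k] on; at most [k] of these events occur. *)
Lemma last_visit (V : S -> motion R -> bool) k H F g : rigid g ->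
  \sum_(n < H.+1)
    avgn n (fun K h => (V K h)%:R * avgn k.+1 (survive V (H - n)) K h) F g
  <= k.+1%:R.
Proof.
(* [b n] is the probability of no visit from time [n] up to the fixed time [H + k]. A last visit at
   time [n] is counted by [b (n + k.+1) - b n]. *)
move=> pg; pose b n := avgn n (survive V (H + k.+1 - n)) F g.
apply: le_trans (sum_shift_le H.+1 k.+1 (_ : forall n, 0 <= b n <= 1)); last first.
  move=> n; apply/andP; split.
    by apply: (avgn_ge0 t_ge0 t_sum c_rigid) => // K h; exact: survive_ge0.
  rewrite -[X in _ <= X](avgn_cst c t_sum n 1 F g).
  by apply: avgn_le => // K h; exact: survive_le1.
apply: ler_sum => -[n /= nH] _.
rewrite /b iterD subnDr -avgnB; apply: avgn_le => // K h ph.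
have -> : (H + k.+1 - n = k.+1 + (H - n))%N by rewrite addnC addnBA.
have -> : survive V (k.+1 + (H - n)) K h =
  iter k.+1 (stay V) (survive V (H - n)) K h by rewrite /survive iterD.
case: (boolP (V K h)) => [VKh|_].
  by rewrite mul1r [X in _ <= _ - X]/= /stay VKh subr0.
rewrite mul0r subr_ge0; apply: iter_stay_avgn => // L l.
exact: survive_ge0.
Qed.

(** If the walk shifted by [h] is within [e] of the identity, the unshifted one is within [4 * e] by
    [near_id_cancel]. Avoiding the larger neighbourhood thus forces the shifted walk to avoid the
    smaller. *)
Lemma survive_shift e N F g h : rigid g -> rigid h -> near_id e h ->
  survive (at_start (4 * e)) N F g <= survive (at_start e) N F (mmul g h).
Proof.
move=> pg ph eh; elim: N F g pg => [//|N IH] F g pg.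
rewrite !surviveS; case: ifP => [aF|aF]; last first.
  rewrite ifN; last first.
    apply: contraFN aF => /andP[FF0 gh]; rewrite /at_start FF0 /=.
    exact: near_id_cancel gh.
  apply: ler_sum => K _; rewrite ler_wpM2l // mmulA; apply: IH.
  exact: rigidM.
case: ifP => // _; apply: sumr_ge0 => K _.
by rewrite mulr_ge0 // survive_ge0 // !rigidM.
Qed.

(** By [survive_shift], each summand in [last_visit] is at least the left-hand side [y] times a
    return probability. The sum of these diverges while the total stays below [k.+1], so [y] is
    small for a long horizon. *)
Lemma recurrent (e : R) k (x : R) : 0 < e -> 0 < x -> exists N,
  avgn k.+1 (survive (at_start (4 * e)) N) F0 mone <= x.
Proof.
(* With this lower bound for the sum, [y > x] would give [k.+2 <= k.+1]. *)
move=> e0 x0; have [[|H] HM] := return_diverges (k.+2%:R / x) e0.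
  by move: HM; rewrite big_ord0 leNgt divr_gt0.
exists H; set y := avgn k.+1 _ F0 mone.
have : y * \sum_(n < H.+1) avgn n (fun K g => (at_start e K g)%:R) F0 mone
    <= k.+1%:R.
  apply: le_trans (last_visit (at_start e) k H F0 (rigid1 R)).
  rewrite mulr_sumr; apply: ler_sum => -[n /= nH] _.
  rewrite -avgnZ; apply: avgn_le (rigid1 R) => K h ph.
  rewrite mulrC; case: (boolP (at_start e K h)) => [|_]; last by rewrite !mul0r.
  rewrite !mul1r => /andP[/eqP -> eh].
  rewrite -[leRHS]/(avgn k.+1 (survive (at_start e) (H - n)) F0 h).
  rewrite avgn_shift; apply: avgn_le (rigid1 R) => L l pl.
  apply: le_trans (survive_shift _ _ _ _ _) => //.
  by apply: survive_anti => //; rewrite leq_subr.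
move=> yH; rewrite leNgt; apply/negP => xy.
have : k.+2%:R <= k.+1%:R :> R.
  apply: le_trans yH; rewrite [leLHS](_ : _ = x * (k.+2%:R / x)); last first.
    by rewrite mulrC divfK // gt_eqF.
  by apply: ler_pM => //; [exact: ltW|rewrite divr_ge0 // ltW|exact: ltW].
by rewrite ler_nat ltnn.
Qed.

(* From any point the walk enters [W] unless it survives it; from [W] it reaches
   [V] within [m] steps with probability at least [x]. *)
Lemma survive_split V W m N (x : R) :
  (forall F g, rigid g -> W F g -> survive V m F g <= 1 - x) -> x <= 1 ->
  forall F g, rigid g -> survive V (N + m) F g <= 1 - x + survive W N F g.
Proof.
move=> Wx x1; elim: N => [|N IH] F g pg.
  rewrite add0n [survive W 0 F g]/= (le_trans (survive_le1 _ _ _ pg)) //; lra.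
case: (boolP (W F g)) => WF.
  rewrite (@le_trans _ _ (1 - x)) ?lerDl ?survive_ge0 //.
  by rewrite (le_trans _ (Wx _ _ pg WF)) // survive_anti // leq_addl.
rewrite addSn !surviveS (negPf WF); case: ifP => _.
  rewrite addr_ge0 ?subr_ge0 //; apply: sumr_ge0 => K _.
  by rewrite mulr_ge0 // survive_ge0 // rigidM.
have -> : 1 - x = \sum_K t F K * (1 - x) by rewrite -mulr_suml t_sum mul1r.
rewrite -big_split.
apply: ler_sum => K _ /=; rewrite -mulrDr ler_wpM2l // IH //.
exact: rigidM.
Qed.

(** After any time the walk comes back near its start, and each return gives a new chance [x] of
    hitting [V]. A round multiplies survival by [1 - x], up to an error [x / 2 * q ^+ j] for failing
    to return, hence by at most [q] in all. *)
Lemma survive_vanishes V m (e x : R) : 0 < e -> 0 < x ->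
  (forall g, rigid g -> near_id e g -> survive V m F0 g <= 1 - x) ->
  forall y : R, 0 < y -> exists N, survive V N F0 mone <= y.
Proof.
move=> e0 x0 Vx.
have x1 : x <= 1.
  have := Vx mone (rigid1 R) (near_id1 (ltW e0)).
  have := survive_ge0 V m F0 (rigid1 R); lra.
pose q := 1 - x / 2; have q0 : 0 < q by rewrite /q; lra.
have decay j : exists N, survive V N F0 mone <= q ^+ j.
  elim: j => [|j [k Hk]]; first by exists 0%N; rewrite expr0.
  have e40 : 0 < e / 4 by rewrite divr_gt0.
  have y0 : 0 < x / 2 * q ^+ j by rewrite mulr_gt0 ?exprn_gt0 ?divr_gt0.
  have [N] := recurrent k e40 y0.
  have -> : 4 * (e / 4) = e by field.
  (* [k.+1] steps with survival at most [q ^+ j], then [N] steps to return near the start, then [m]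
     steps to hit [V]. *)
  move=> HN; exists (k.+1 + (N + m))%N.
  have -> : survive V (k.+1 + (N + m)) F0 mone =
    iter k.+1 (stay V) (survive V (N + m)) F0 mone by rewrite /survive iterD.
  apply: (@le_trans _ _ ((1 - x) * survive V k.+1 F0 mone +
     avgn k.+1 (survive (at_start e) N) F0 mone)).
    have split F g : rigid g -> survive V (N + m) F g <=
        1 - x + survive (at_start e) N F g.
      apply: survive_split => // {F g} F g pg /andP[/eqP -> eg].
      exact: Vx.
    have stayD n f a F g : rigid g -> (forall F g, rigid g -> 0 <= f F g) ->
      iter n (stay V) (fun K h => a + f K h) F g <=
      a * survive V n F g + avgn n f F g.
      move=> pg f0.
      apply: (@le_trans _ _ (a * survive V n F g + iter n (stay V) f F g)).
        elim: n F g pg => [|n IH] F g pg; first by rewrite mulr1.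
        rewrite surviveS iterS /= /stay; case: ifP => _; first by rewrite mulr0 addr0.
        rewrite mulr_sumr -big_split ler_sum // => K _ /=.
        rewrite mulrCA -mulrDr ler_wpM2l // IH //; exact: rigidM.
      by rewrite lerD2l iter_stay_avgn.
    apply: le_trans (stayD _ _ _ _ _ (rigid1 R) _); last exact: survive_ge0.
    exact: iter_stay_le (rigid1 R).
  rewrite exprS.
  have := survive_anti V F0 (rigid1 R) (leqnSn k).
  have : (1 - x) * survive V k.+1 F0 mone <= (1 - x) * q ^+ j.
    rewrite ler_wpM2l ?subr_ge0 // (le_trans _ Hk) // survive_anti //.
    exact: rigid1.
  rewrite {2}/q; lra.
move=> y y0.
have /cvgrPdist_le /(_ _ y0) : (fun n => q ^+ n) @ \oo --> (0 : R).
  by apply: cvg_expr; rewrite gtr0_norm // /q; lra.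
case=> j _ /(_ j (leqnn j)); rewrite sub0r normrN gtr0_norm ?exprn_gt0 // => qy.
by have [N HN] := decay j; exists N; exact: le_trans qy.
Qed.

End Recurrence.

(** * Positions and rolls of a polytope *)

Section PlaneAction.
Variable R : realType.
Implicit Types (x y : 'rV[R]_3) (g h : motion R).

(** The block sizes are explicit because [3] is [2 + 1] only up to conversion. *)
Definition shadow x : 'rV[R]_2 := @lsubmx R 1 2 1 x.

Definition mv g x : 'rV[R]_3 :=
  row_mx (shadow x *m g.1 + g.2) (@rsubmx R 1 2 1 x).

Definition direct g := rigid g && (\det g.1 == 1).

Lemma ord_max3 : ord_max = rshift 2 ord0 :> 'I_3.
Proof. exact/val_inj. Qed.

Lemma height_row (y : 'rV[R]_2) (z : 'rV[R]_1) : height (row_mx y z) = z 0 0.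
Proof. by rewrite /height ord_max3 (@row_mxEr R 1 2 1). Qed.

Lemma heightE x : height x = (@rsubmx R 1 2 1 x) 0 0.
Proof. by rewrite mxE /height ord_max3. Qed.

Lemma vec3_eq x y : shadow x = shadow y -> height x = height y -> x = y.
Proof.
move=> sxy hxy; have rxy : @rsubmx R 1 2 1 x = @rsubmx R 1 2 1 y.
  by apply/rowP => i; rewrite ord1 -!heightE.
transitivity (@row_mx R 1 2 1 (shadow x) (@rsubmx R 1 2 1 x)).
  by rewrite /shadow hsubmxK.
by rewrite sxy rxy /shadow hsubmxK.
Qed.

Lemma shadow_mv g x : shadow (mv g x) = shadow x *m g.1 + g.2.
Proof. by rewrite /shadow row_mxKl. Qed.

Lemma height_mv g x : height (mv g x) = height x.
Proof. by rewrite height_row heightE. Qed.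

Lemma mvM g h x : mv (mmul g h) x = mv h (mv g x).
Proof.
apply: vec3_eq; rewrite ?height_mv // !shadow_mv /=.
by rewrite mulmxDl mulmxA addrA.
Qed.

Lemma mv1 x : mv mone x = x.
Proof. by apply: vec3_eq; rewrite ?height_mv // shadow_mv mulmx1 addr0. Qed.

Lemma shadow_plane (y : 'rV[R]_2) : shadow (plane_point y) = y.
Proof. by rewrite /shadow row_mxKl. Qed.

Lemma height_plane (y : 'rV[R]_2) : height (plane_point y) = 0.
Proof. by rewrite height_row mxE. Qed.

Lemma mv_plane g (y : 'rV[R]_2) :
  mv g (plane_point y) = plane_point (y *m g.1 + g.2).
Proof.
apply: vec3_eq; first by rewrite shadow_mv !shadow_plane.
by rewrite height_mv !height_plane.
Qed.

Definition lift_mx (A : 'M[R]_2) : 'M[R]_3 := @block_mx R 2 1 2 1 A 0 0 1%:M.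

Definition lift_row (b : 'rV[R]_2) : 'rV[R]_3 := @row_mx R 1 2 1 b 0.

Lemma mvE g x : mv g x = x *m lift_mx g.1 + lift_row g.2.
Proof.
rewrite /mv -[in RHS](@hsubmxK R 1 2 1 x) /lift_mx /lift_row.
rewrite (@mul_row_block R 1 2 1 2 1) !mulmx0 mulmx1 addr0 add0r.
by rewrite (@add_row_mx R 1 2 1) addr0.
Qed.

Lemma lift_mx_rigid g : rigid g -> lift_mx g.1 *m (lift_mx g.1)^T = 1%:M.
Proof.
move=> /eqP gg; rewrite /lift_mx (@tr_block_mx R 2 1 2 1).
rewrite (@mulmx_block R 2 1 2 1 2 1) !trmx0 trmx1 !mul0mx !mulmx0 mulmx1 gg.
by rewrite !addr0 add0r -(@scalar_mx_block R 2 1).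
Qed.

Lemma det_lift_mx A : \det (lift_mx A) = \det A.
Proof. by rewrite /lift_mx (@det_ublock R 2 1) det1 mulr1. Qed.

Lemma direct1 : direct (@mone R).
Proof. by rewrite /direct rigid1 det1 eqxx. Qed.

Lemma directV g : direct g -> direct (minv g).
Proof. by case/andP=> rg dg; rewrite /direct rigidV //= det_tr. Qed.

Lemma directM g h : direct g -> direct h -> direct (mmul g h).
Proof.
case/andP=> rg /eqP dg /andP[rh /eqP dh].
by rewrite /direct rigidM //= det_mulmx dg dh mulr1.
Qed.

Lemma ord2P (j : 'I_2) : j = 0 \/ j = 1.
Proof. by case: j => -[|[|//]] jP; [left|right]; exact/val_inj. Qed.

Lemma det2 (A : 'M[R]_2) : \det A = A 0 0 * A 1 1 - A 0 1 * A 1 0.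
Proof.
rewrite (expand_det_row _ ord0) !big_ord_recl big_ord0 /cofactor !det_mx11 !mxE /=.
rewrite (_ : lift ord0 ord0 = 1); last exact/val_inj.
rewrite (_ : lift 1 0 = 0); last exact/val_inj.
by rewrite /bump /= addn0 expr0 expr1 mul1r addr0 mulN1r mulrN.
Qed.

Lemma rotation_fix (A : 'M[R]_2) (z : 'rV[R]_2) :
  A *m A^T = 1%:M -> \det A = 1 -> z != 0 -> z *m A = z -> A = 1%:M.
Proof.
rewrite det2 => AA dA z0 zA.
have e i j : A i 0 * A j 0 + A i 1 * A j 1 = (i == j)%:R.
  have := congr1 (fun M : 'M[R]_2 => M i j) AA.
  by rewrite !mxE !big_ord_recl big_ord0 addr0 !mxE
    (_ : lift ord0 ord0 = 1) //; exact/val_inj.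
have f j : z 0 0 * A 0 j + z 0 1 * A 1 j = z 0 j.
  have := congr1 (fun M : 'rV[R]_2 => M 0 j) zA.
  by rewrite !mxE !big_ord_recl big_ord0 addr0
    (_ : lift ord0 ord0 = 1) //; exact/val_inj.
have /= e00 := e 0 0; have /= e01 := e 0 1; have /= e11 := e 1 1.
have /= f0 := f 0; have /= f1 := f 1.
have zz : z 0 0 ^+ 2 + z 0 1 ^+ 2 != 0.
  apply: contra_neq z0 => /eqP; rewrite paddr_eq0 ?sqr_ge0 // !sqrf_eq0.
  move=> /andP[/eqP h0 /eqP h1]; apply/rowP => j; rewrite mxE.
  by case: (ord2P j) => ->.
(* The squared norms of the rows minus twice the determinant: [1 + 1 - 2]. Hence [A] has rows
   [(a, b)] and [(-b, a)]. *)
have eqs : (A 0 0 - A 1 1) ^+ 2 + (A 0 1 + A 1 0) ^+ 2 = 0.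
  rewrite [LHS](_ : _ = A 0 0 * A 0 0 + A 0 1 * A 0 1 + (A 1 0 * A 1 0 + A 1 1 * A 1 1)
    - 2 * (A 0 0 * A 1 1 - A 0 1 * A 1 0)); last by ring.
  by rewrite e00 e11 dA; ring.
have [ad bc] : A 1 1 = A 0 0 /\ A 1 0 = - A 0 1.
  move/eqP: eqs; rewrite paddr_eq0 ?sqr_ge0 // !sqrf_eq0 subr_eq0 addr_eq0.
  by move=> /andP[/eqP -> /eqP ->]; rewrite opprK.
rewrite ad bc in f0 f1.
have a1 : A 0 0 = 1.
  apply: (mulfI zz); rewrite [LHS](_ : _ = z 0 0 * (z 0 0 * A 0 0 + z 0 1 * - A 0 1)
    + z 0 1 * (z 0 0 * A 0 1 + z 0 1 * A 0 0)); last by ring.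
  by rewrite f0 f1; ring.
have b0 : A 0 1 = 0.
  apply: (mulfI zz); rewrite [LHS](_ : _ = z 0 0 * (z 0 0 * A 0 1 + z 0 1 * A 0 0)
    - z 0 1 * (z 0 0 * A 0 0 + z 0 1 * - A 0 1)); last by ring.
  by rewrite f0 f1; ring.
rewrite a1 in ad; rewrite b0 oppr0 in bc.
apply/matrixP => i j; rewrite mxE.
by case: (ord2P i) (ord2P j) => -> [] -> /=; rewrite ?a1 ?b0 ?ad ?bc.
Qed.

Lemma direct_fix2 g x y : direct g -> height x = height y -> x != y ->
  mv g x = x -> mv g y = y -> g = mone.
Proof.
case/andP=> /eqP gg /eqP dg hxy xy gx gy.
have z0 : shadow x - shadow y != 0.
  by apply: contra_neq xy => /eqP; rewrite subr_eq0 => /eqP /vec3_eq ->.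
have ex : shadow x *m g.1 + g.2 = shadow x by rewrite -shadow_mv gx.
have ey : shadow y *m g.1 + g.2 = shadow y by rewrite -shadow_mv gy.
have A1 : g.1 = 1%:M.
  apply: rotation_fix z0 _ => //; rewrite mulmxBl -[in RHS]ex -[in RHS]ey.
  by rewrite opprD addrACA subrr addr0.
move: ex; rewrite A1 mulmx1 -[RHS]addr0 => /addrI b0.
by case: g A1 b0 {gg dg gx gy ey} => A b /= -> ->.
Qed.

End PlaneAction.

(** * Congruent positions and facets of a polytope *)

Section Polyhedron.
Variables (R : realType) (n : nat).
Implicit Types (p q : 'M[R]_(n, 3)) (S e : {set 'I_n}) (g h : motion R).

Definition act p g : 'M[R]_(n, 3) := \matrix_i mv g (row i p).

Lemma row_act p g i : row i (act p g) = mv g (row i p).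
Proof. exact: rowK. Qed.

Lemma actM p g h : act p (mmul g h) = act (act p g) h.
Proof. by apply/row_matrixP => i; rewrite !row_act mvM. Qed.

Lemma act1 p : act p mone = p.
Proof. by apply/row_matrixP => i; rewrite row_act mv1. Qed.

Lemma polytope_row p i : polytope p (row i p).
Proof.
exists (delta_mx 0 i); split; last by rewrite rowE.
- by move=> j; rewrite mxE eqxx ler0n.
- by move=> j; rewrite inE.
- rewrite (bigD1 i) //= big1 ?addr0 ?mxE ?eqxx // => j /negPf ji.
  by rewrite mxE ji andbF.
Qed.

Lemma hull_row p S i : i \in S -> hull p S (row i p).
Proof.
move=> iS; exists (delta_mx 0 i); split; last by rewrite rowE.
- by move=> j; rewrite mxE eqxx ler0n.
- move=> j jS; rewrite mxE eqxx /=; case: eqP => // ji.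
  by rewrite ji iS in jS.
- rewrite (bigD1 i) //= big1 ?addr0 ?mxE ?eqxx // => j /negPf ji.
  by rewrite mxE ji andbF.
Qed.

Lemma height_sum p (w : 'rV[R]_n) :
  height (w *m p) = \sum_i w 0 i * height (row i p).
Proof. by rewrite /height mxE; apply: eq_bigr => i _; rewrite mxE. Qed.

Lemma restingP p S : resting p S <->
  (forall i, i \in S -> height (row i p) = 0) /\
  (forall i, 0 <= height (row i p)).
Proof.
split=> -[h0 hge]; split.
- by move=> i iS; apply: h0; apply: hull_row.
- by move=> i; apply: hge; apply: polytope_row.
- move=> x [w [w0 wS w1 ->]].
  rewrite height_sum big1 // => i _; case: (boolP (i \in S)) => iS.
    by rewrite h0 // mulr0.
  by rewrite wS // mul0r.
- move=> x [w [w0 wS w1 ->]].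
  by rewrite height_sum sumr_ge0 // => i _; rewrite mulr_ge0.
Qed.

Lemma resting_act p S g : resting p S -> resting (act p g) S.
Proof.
move=> /restingP[h0 hge]; apply/restingP; split.
  by move=> i iS; rewrite row_act height_mv h0.
by move=> i; rewrite row_act height_mv.
Qed.

Definition congruent p q := exists (A : 'M[R]_3) (b : 'rV[R]_3),
  [/\ A *m A^T = 1%:M, \det A = 1 & forall i, row i q = row i p *m A + b].

Lemma congruent_refl p : congruent p p.
Proof.
exists 1%:M, 0; rewrite trmx1 mulmx1 det1; split=> // i.
by rewrite mulmx1 addr0.
Qed.

Lemma congruent_sym p q : congruent p q -> congruent q p.
Proof.
move=> [A [b [AA dA pq]]]; exists A^T, (- (b *m A^T)).
rewrite trmxK det_tr dA; split=> // [|i]; first exact: mulmx1C.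
by rewrite pq mulmxDl -mulmxA AA mulmx1 addrK.
Qed.

Lemma congruent_trans p q r : congruent p q -> congruent q r -> congruent p r.
Proof.
move=> [A [b [AA dA pq]]] [B [d [BB dB qr]]].
exists (A *m B), (b *m B + d); split=> [||i].
- by rewrite trmx_mul mulmxA -(mulmxA A) BB mulmx1.
- by rewrite det_mulmx dA dB mulr1.
- by rewrite qr pq mulmxDl mulmxA addrA.
Qed.

Lemma congruent_act p g : direct g -> congruent p (act p g).
Proof.
case/andP=> rg /eqP dg; exists (lift_mx g.1), (lift_row g.2).
rewrite lift_mx_rigid // det_lift_mx; split=> // i.
by rewrite row_act mvE.
Qed.

Definition dirs p S := (\sum_(i in S) \sum_(j in S) <<row j p - row i p>>)%MS.

Lemma dirs_sub p S m (M : 'M[R]_(m, 3)) : reflect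
  (forall i j, i \in S -> j \in S -> (row j p - row i p <= M)%MS)
  (dirs p S <= M)%MS.
Proof.
apply: (iffP sumsmx_subP) => [H i j iS jS|H i iS].
  by have /sumsmx_subP /(_ j jS) := H i iS; rewrite genmxE.
by apply/sumsmx_subP => j jS; rewrite genmxE H.
Qed.

Lemma dirs_mem p S i j : i \in S -> j \in S -> (row j p - row i p <= dirs p S)%MS.
Proof. by move: i j; apply/dirs_sub. Qed.

Lemma affdimE p S : affdim p S = \rank (dirs p S).
Proof. by []. Qed.

Lemma affdim_gt0 p S : (0 < affdim p S)%N ->
  exists i j, [/\ i \in S, j \in S & row i p != row j p].
Proof.
rewrite affdimE lt0n mxrank_eq0 -submx0 => /dirs_sub H; apply/not_existsP => H'.
apply: H => i j iS jS; rewrite submx0 subr_eq0 eq_sym.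
by apply/negP => /negP ij; apply: (H' i); exists j; rewrite ij.
Qed.

Lemma affdim_congr p q S : congruent p q -> affdim q S = affdim p S.
Proof.
suff le p' q' : congruent p' q' -> (affdim q' S <= affdim p' S)%N.
  by move=> pq; apply/eqP; rewrite eqn_leq !le //; exact: congruent_sym.
move=> [A [b [_ _ pq]]]; rewrite !affdimE.
apply: leq_trans (mxrankM_maxl _ A); apply: mxrankS; apply/dirs_sub => i j iS jS.
by rewrite !pq opprD addrACA subrr addr0 -mulmxBl submxMr // dirs_mem.
Qed.

Definition up : 'cV[R]_3 := delta_mx ord_max 0.

Lemma height_up (x : 'rV[R]_3) : height x = (x *m up) 0 0.
Proof.
rewrite mxE (bigD1 ord_max) //= big1 => [|i /negPf i3]; last first.
  by rewrite mxE i3 mulr0.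
by rewrite mxE !eqxx mulr1 addr0.
Qed.

Lemma height_eq0 (x : 'rV[R]_3) : (height x == 0) = (x <= kermx up)%MS.
Proof.
rewrite (sameP sub_kermxP eqP) height_up; apply/eqP/eqP => [h|->]; last by rewrite mxE.
by apply/rowP => i; rewrite ord1 h mxE.
Qed.

Lemma rank_ker_up : \rank (kermx up) = 2%N.
Proof. by rewrite mxrank_ker mxrank_delta. Qed.

Lemma heightB (x y : 'rV[R]_3) : height (x - y) = height x - height y.
Proof. by rewrite /height !mxE. Qed.

Lemma heightD (x y : 'rV[R]_3) : height (x + y) = height x + height y.
Proof. by rewrite /height !mxE. Qed.

(* The direction space of a two-dimensional face in the plane is the whole
   plane, so the isometry between the two positions preserves the plane. *)
Lemma resting_motion p q S : affdim p (finset.setTfor 'I_n) = 3%N ->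
  affdim p S = 2%N -> congruent p q -> resting p S -> resting q S ->
  exists2 g, direct g & q = act p g.
Proof.
move=> p3 pS [B [d [BB dB pq]]] /restingP[p0 pge] /restingP[q0 qge].
have [i [_ [iS _ _]]] : exists i j, [/\ i \in S, j \in S & row i p != row j p].
  by apply: affdim_gt0; rewrite pS.
have dker : (kermx up <= dirs p S)%MS.
  have sub : (dirs p S <= kermx up)%MS.
    by apply/dirs_sub => j k jS kS; rewrite -height_eq0 heightB !p0 // subrr.
  by rewrite -(mxrank_leqif_sup sub).2 rank_ker_up -affdimE pS.
have hB x : height x = 0 -> height (x *m B) = 0.
  move=> /eqP; rewrite height_eq0 => xk; apply/eqP.
  have : (x <= kermx (B *m up))%MS.
    apply: submx_trans xk (submx_trans dker _).
    apply/dirs_sub => j k jS kS; apply/sub_kermxP.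
    have := heightB (row k q) (row j q); rewrite !q0 // subrr.
    rewrite !pq opprD addrACA subrr addr0 -mulmxBl => /eqP.
    by rewrite height_eq0 => /sub_kermxP; rewrite mulmxA.
  by move=> /sub_kermxP; rewrite mulmxA height_eq0 => H; apply/sub_kermxP.
pose B2 := @ulsubmx R 2 1 2 1 B; pose s := @drsubmx R 2 1 2 1 B.
have Bur : @ursubmx R 2 1 2 1 B = 0.
  apply/matrixP => k l; rewrite ord1 [RHS]mxE.
  transitivity (height (delta_mx 0 (@lshift 2 1 k) *m B)).
    by rewrite -rowE /height ord_max3 !mxE.
  by apply: hB; rewrite /height mxE eqxx -val_eqE /= gtn_eqF.
have : B = @block_mx R 2 1 2 1 B2 0 (@dlsubmx R 2 1 2 1 B) s.
  by rewrite -Bur submxK.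
set r := dlsubmx _ => BE; clearbody B2 s r.
move: BB; rewrite BE (@tr_block_mx R 2 1 2 1) (@mulmx_block R 2 1 2 1 2 1).
rewrite (@scalar_mx_block R 2 1) !trmx0 !mulmx0 !mul0mx !addr0.
move=> /(@eq_block_mx R 2 1 2 1)[B2B2 B2r _ rs].
have r0 : r = 0.
  by apply: trmx_inj; rewrite trmx0 -[LHS]mul1mx -(mulmx1C B2B2) -mulmxA B2r mulmx0.
move: rs; rewrite r0 mul0mx add0r => ss.
have s2 : s 0 0 ^+ 2 = 1.
  move/(congr1 (fun M : 'M[R]_1 => M 0 0)): ss.
  by rewrite !mxE big_ord1 mxE eqxx mulr1n expr2.
rewrite r0 in BE.
have xB x : x *m B = row_mx (shadow x *m B2) (@rsubmx R 1 2 1 x *m s) :> 'rV_3.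
  rewrite -{1}(@hsubmxK R 1 2 1 x) BE (@mul_row_block R 1 2 1 2 1).
  by rewrite !mulmx0 addr0 add0r.
have hxB x : height (x *m B) = height x * s 0 0.
  by rewrite xB height_row heightE mxE big_ord1.
have hd : height d = 0.
  have := q0 i iS; rewrite pq heightD hxB p0 // mul0r add0r //.
have hq k : height (row k q) = height (row k p) * s 0 0.
  by rewrite pq heightD hxB hd addr0.
(* The value [-1] would reflect heights; as both positions lie above the plane, all heights would
   vanish, against dimension three. *)
have s1 : s 0 0 = 1.
  have /eqP := s2; rewrite sqrf_eq1 => /orP[/eqP //|/eqP sN].
  suff : (affdim p (finset.setTfor 'I_n) <= 2)%N by rewrite p3.
  rewrite affdimE -[leqRHS]rank_ker_up mxrankS //; apply/dirs_sub => j k _ _.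
  have h0 l : height (row l p) = 0.
    by have := qge l; have := pge l; rewrite hq sN; lra.
  by rewrite -height_eq0 heightB !h0 subrr.
have s11 : s = 1%:M by apply/matrixP => k l; rewrite !ord1 s1 mxE eqxx.
exists (B2, shadow d).
  rewrite /direct /rigid /= B2B2 eqxx /=.
  by move: dB; rewrite BE (@det_ublock R 2 1) s11 det1 mulr1 => ->.
apply/row_matrixP => k; rewrite row_act; apply: vec3_eq.
  by rewrite shadow_mv pq xB /shadow linearD /= row_mxKl.
by rewrite height_mv hq s1 mulr1.
Qed.

Lemma dotE (x c : 'rV[R]_3) : dot x c = (c *m x^T) 0 0.
Proof. by rewrite mxE; apply: eq_bigr => k _; rewrite mxE mulrC. Qed.

Lemma is_face_dirs p S : is_face p S -> exists c : 'rV[R]_3,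
  forall i j, i \in S -> (j \in S) = (row j p - row i p <= kermx c^T)%MS.
Proof.
move=> [c [b [_ _ cS]]]; exists c => i j; rewrite !cS => /eqP ib.
rewrite (sameP sub_kermxP eqP) mulmxBl subr_eq0 -ib !dotE.
apply/eqP/eqP => [h|->//].
by apply/rowP => k; rewrite ord1 h.
Qed.

(** The edge and the vertex [i] off it span a plane, which is the affine span of both facets, and a
    face contains every vertex lying in its affine span. *)
Lemma facet_eq p S S' e i : is_facet p S -> is_facet p S' -> is_edge p e ->
  e \subset S -> e \subset S' -> i \in S -> i \in S' -> i \notin e -> S = S'.
Proof.
move=> fS fS' [fe e1] /fintype.subsetP eS /fintype.subsetP eS' iS iS' ie.
have [j [_ [je _ _]]] : exists i j, [/\ i \in e, j \in e & row i p != row j p].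
  by apply: affdim_gt0; rewrite e1.
have [c cP] := is_face_dirs fe.
pose M := (dirs p e + <<(row i p - row j p)>>)%MS.
(* Otherwise the direction towards [i] is already one of the edge, and [is_face_dirs] puts [i] into
   [e]. *)
have M2 : (1 < \rank M)%N.
  rewrite -[X in (X < _)%N]e1 affdimE ltn_neqAle mxrankS ?addsmxSl // andbT.
  apply: contraNN ie => /eqP rk; rewrite (cP j) //.
  have sub : (dirs p e <= M)%MS by rewrite addsmxSl.
  have : (M <= dirs p e)%MS by rewrite -(mxrank_leqif_sup sub).2 rk.
  move=> Me; apply: (submx_trans _ (submx_trans Me _)).
    by have := addsmxSr (dirs p e) <<(row i p - row j p)>>%MS; rewrite genmxE.
  apply/dirs_sub => k l ke le; rewrite -(cP k) //.
have sM S1 : is_facet p S1 -> (forall x, x \in e -> x \in S1) -> i \in S1 ->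
    (dirs p S1 :=: M)%MS.
  move=> [_ S12] eS1 iS1.
  have sub : (M <= dirs p S1)%MS.
    rewrite addsmx_sub; apply/andP; split.
      by apply/dirs_sub => k l ke le; rewrite dirs_mem // eS1.
    by rewrite genmxE dirs_mem // eS1.
  apply/eqmxP; rewrite sub andbT -(mxrank_leqif_sup sub).2 -affdimE S12.
  by have := mxrankS sub; rewrite -affdimE S12 eqn_leq M2 andbT.
have incl S1 S2 : is_facet p S1 -> is_facet p S2 ->
    (forall x, x \in e -> x \in S1) -> (forall x, x \in e -> x \in S2) ->
    i \in S1 -> i \in S2 -> S1 \subset S2.
  move=> f1 f2 e1' e2 i1 i2; apply/fintype.subsetP => k k1.
  have [c2 c2P] := is_face_dirs f2.1.
  rewrite (c2P i) //; apply: (@submx_trans _ _ _ _ _ _ (dirs p S2)).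
    by rewrite (sM S2) // -(sM S1) // dirs_mem.
  by apply/dirs_sub => l m l2 m2; rewrite -(c2P l).
by apply/eqP; rewrite finset.eqEsubset !incl.
Qed.

End Polyhedron.

(** * Rolls and planar motions *)

Section RollingGeometry.
Variables (R : realType) (n : nat) (v : 'M[R]_(n, 3)).
Implicit Types (s : config v) (F : facet v) (g h : motion R) (e : {set 'I_n}).

Definition placed s := congruent v s.1 /\ resting s.1 (val s.2).

Lemma facetP F : is_facet v (val F).
Proof. exact/asboolP/(valP F). Qed.

Lemma common_edge_sym F F' e : common_edge F F' e -> common_edge F' F e.
Proof. by case=> h1 h2 h3; split. Qed.

(** A vertex of one common edge outside the other would make the two facets equal by [facet_eq]. *)
Lemma common_edge_uniq F F' e e' : F != F' ->
  common_edge F F' e -> common_edge F F' e' -> e = e'.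
Proof.
move=> FF' [he eF eF'] [he' e'F e'F'].
have sub e1 e2 : is_edge v e2 -> e1 \subset val F -> e1 \subset val F' ->
    e2 \subset val F -> e2 \subset val F' -> e1 \subset e2.
  move=> he2 /fintype.subsetP e1F /fintype.subsetP e1F' e2F e2F'.
  apply/fintype.subsetP => i ie; apply: contraNT FF' => ie2; apply/eqP/val_inj.
  exact: (facet_eq (facetP F) (facetP F') he2 e2F e2F' (e1F _ ie) (e1F' _ ie)).
by apply/eqP; rewrite finset.eqEsubset; apply/andP; split; exact: sub.
Qed.

Lemma rolls_adj s s' : rolls s s' -> adj s.2 s'.2.
Proof.
by move=> [ss' [e [rho [he _ _ _]]]]; rewrite /adj ss'; apply/asboolP; exists e.
Qed.

Lemma adj_sym F F' : adj F F' = adj F' F.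
Proof.
rewrite /adj eq_sym; congr (_ && _); apply: asbool_equiv_eq.
by split=> -[e /common_edge_sym he]; exists e.
Qed.

Lemma edge_line_row (p : 'M[R]_(n, 3)) e i : i \in e -> edge_line p e (row i p).
Proof. by move=> ie; exists i, i, 0; rewrite scale0r addr0. Qed.

Lemma rolls_congruent s s' : rolls s s' -> congruent s.1 s'.1.
Proof.
move=> [_ [e [rho [_ [[A [b [AA dA rhoE]]] _] ss' _]]]].
by exists A, b; split=> // i; rewrite ss' rhoE.
Qed.

Lemma rolls_placed s s' : placed s -> rolls s s' -> placed s'.
Proof.
move=> [vs _] ss'; split; first exact: congruent_trans (rolls_congruent ss').
by case: ss' => _ [e [rho [_ _ _]]].
Qed.

Lemma placed_act s g : direct g -> placed s -> placed (act s.1 g, s.2).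
Proof.
move=> dg [vs rs]; split; last exact: resting_act.
exact: congruent_trans (congruent_act _ dg).
Qed.

(** A face of positive dimension lying in the plane has two distinct vertices, and a direct planar
    motion fixing both is trivial. It serves for an edge in [rolls_uniq] and for a facet in
    [act_free]. *)
Lemma placed_fix s e g : affdim v e = 1%N \/ affdim v e = 2%N ->
  e \subset val s.2 -> placed s -> direct g ->
  (forall i, i \in e -> mv g (row i s.1) = row i s.1) -> g = mone.
Proof.
move=> e1 /fintype.subsetP es [vs /restingP[s0 _]] dg gs.
have [i [j [ie je ij]]] :
    exists i j, [/\ i \in e, j \in e & row i s.1 != row j s.1].
  by apply: affdim_gt0; rewrite (affdim_congr _ vs); case: e1 => ->.
by apply: direct_fix2 ij _ _ => //; rewrite ?gs // !s0 // es.
Qed.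

Lemma act_free s g h : placed s -> direct g -> direct h ->
  act s.1 g = act s.1 h -> g = h.
Proof.
move=> ps dg dh gh.
have rh : rigid h by case/andP: dh.
suff E : mmul g (minv h) = mone by rewrite -[g]mmulm1 -(mmulVm rh) mmulA E mmul1m.
apply: (@placed_fix s (val s.2)) => //.
- by right; have [] := facetP s.2.
- exact: directM dg (directV dh).
move=> i _; have := congr1 (row i) gh; rewrite !row_act => ghi.
by rewrite mvM ghi -mvM mmulmV // mv1.
Qed.

Lemma placed_motion s s' : is_polytope3 v -> placed s -> placed s' ->
  s.2 = s'.2 -> exists2 g, direct g & s' = (act s.1 g, s.2).
Proof.
move=> [_ v3] [vs rs] [vs' rs'] ss'.
have [|||||g dg gE] := @resting_motion _ _ s.1 s'.1 (val s.2).
- by rewrite (affdim_congr _ vs).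
- by rewrite (affdim_congr _ vs); have [] := facetP s.2.
- exact: congruent_trans (congruent_sym vs) vs'.
- exact: rs.
- by rewrite ss'.
by exists g => //; rewrite -gE ss'; case: (s').
Qed.

(** Two outcomes with the same supporting face differ by a planar motion; both rolls fix the common
    edge, so this motion is trivial. *)
Lemma rolls_uniq s s1 s2 : is_polytope3 v -> placed s ->
  rolls s s1 -> rolls s s2 -> s1.2 = s2.2 -> s1 = s2.
Proof.
move=> pv ps r1 r2 s12.
have ps1 := rolls_placed ps r1; have ps2 := rolls_placed ps r2.
have [g dg s2E] := placed_motion pv ps1 ps2 s12.
case: r1 r2 => [ne [e [rho [he [_ fix1] row1 _]]]].
move=> [_ [e' [rho' [he' [_ fix2] row2 _]]]].
have ee' : e' = e by apply: common_edge_uniq ne _ _; rewrite ?s12 // -s12.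
rewrite ee' in fix2; suff g1 : g = mone by rewrite s2E g1 act1; case: (s1).
apply: (@placed_fix s1 e) => //.
- by left; case: he => -[].
- by case: he.
move=> i ie; have := congr1 (fun s => row i s.1) s2E; rewrite /= row_act => <-.
by rewrite row1 row2 fix1 ?fix2 //; exact: edge_line_row.
Qed.

Lemma rolls_sym s s' : resting s.1 (val s.2) -> rolls s s' -> rolls s' s.
Proof.
move=> rs [ne [e [rho [he [[A [b [AA dA rhoE]]] fix_e] row_s' _]]]].
split; first by rewrite eq_sym.
pose rho' (x : 'rV[R]_3) := x *m A^T - b *m A^T.
have rhoK x : rho' (rho x) = x.
  by rewrite /rho' rhoE mulmxDl -mulmxA AA mulmx1 addrK.
exists e, rho'; split.
- exact: common_edge_sym.
- split; first by exists A^T, (- (b *m A^T)); rewrite trmxK det_tr (mulmx1C AA).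
  move=> x [i [j [u [ie je xE]]]].
  rewrite -{1}(_ : rho x = x) ?rhoK //; apply: (fix_e); exists i, j, u.
  rewrite xE !row_s' !fix_e //; exact: edge_line_row.
- by move=> i; rewrite row_s' rhoK.
- exact: rs.
Qed.

Lemma mv_line g (x y : 'rV[R]_3) (u : R) :
  mv g (x + u *: (y - x)) = mv g x + u *: (mv g y - mv g x).
Proof.
by rewrite !mvE opprD addrACA subrr addr0 -mulmxBl scalemxAl addrAC -mulmxDl.
Qed.

Lemma rolls_act s s' g : direct g -> rolls s s' ->
  rolls (act s.1 g, s.2) (act s'.1 g, s'.2).
Proof.
move=> /andP[rg /eqP dg] [ne [e [rho [he [[A [b [AA dA rhoE]]] fix_e] row_s' rs]]]].
split=> //.
set L := lift_mx g.1; set l := lift_row g.2.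
have LL : L *m L^T = 1%:M by exact: lift_mx_rigid.
(* The conjugate of [rho] by [g]. *)
pose rho' (x : 'rV[R]_3) := x *m (L^T *m A *m L) + ((b - l *m L^T *m A) *m L + l).
have rhoM x : rho' (mv g x) = mv g (rho x).
  rewrite /rho' !mvE -/L -/l rhoE !mulmxDl mulNmx !mulmxA.
  rewrite -(mulmxA x L) LL mulmx1.
  rewrite -!addrA; congr (_ + _); rewrite addrCA; congr (_ + _).
  by rewrite addrA subrr add0r.
exists e, rho'; split=> //.
- split.
    exists (L^T *m A *m L), ((b - l *m L^T *m A) *m L + l); split=> //.
      rewrite !trmx_mul trmxK !mulmxA -(mulmxA _ L) LL mulmx1.
      by rewrite -(mulmxA _ A) AA mulmx1 (mulmx1C LL).
    by rewrite !det_mulmx det_tr dA det_lift_mx dg !mulr1.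
  move=> x [i [j [u [ie je ->]]]]; rewrite !row_act -mv_line rhoM fix_e //.
  by exists i, j, u.
- by move=> i; rewrite !row_act rhoM row_s'.
- exact: resting_act.
Qed.

End RollingGeometry.

(** * The rolling process *)

Section Cylinders.
Variables (R : realType) (d : measure_display) (Omega : measurableType d).
Variables (P : probability Omega R) (S : finType) (t : S -> S -> R) (F0 : S).
Variable X : nat -> Omega -> S.
Hypothesis mX : markov_chain P t F0 X.
Implicit Types (s : nat -> S) (F K : S).

Definition cyl k s : set Omega := [set w | forall j, (j <= k)%N -> X j w = s j].

Definition upd s k F : nat -> S := fun j => if j == k then F else s j.

Lemma updE s k F : upd s k F k = F.
Proof. by rewrite /upd eqxx. Qed.

Lemma cyl_upd k s F w : cyl k.+1 (upd s k.+1 F) w <-> cyl k s w /\ X k.+1 w = F.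
Proof.
split=> [c|[c e] j].
  split=> [j jk|]; last by rewrite c // updE.
  by rewrite c ?(leqW jk) // /upd ltn_eqF.
by rewrite leq_eqVlt /upd => /orP[/eqP ->|jk]; rewrite ?eqxx // ltn_eqF // c.
Qed.

Lemma measurable_cyl k s : measurable (cyl k s).
Proof.
elim: k => [|k IH].
  have [mX1 _ _] := mX.
  suff -> : cyl 0 s = X 0%N @^-1` [set s 0%N] by exact: mX1.
  by apply/seteqP; split=> w /= h => [|j]; [exact: h|rewrite leqn0 => /eqP ->].
have [mX1 _ _] := mX.
suff -> : cyl k.+1 s = cyl k s `&` X k.+1 @^-1` [set s k.+1].
  exact: measurableI.
apply/seteqP; split=> w /= h; first by split=> [j jk|]; apply: h => //; exact: leqW.
by move=> j; rewrite leq_eqVlt => /orP[/eqP ->|jk]; [exact: h.2|exact: h.1].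
Qed.

Lemma prob_cyl0 : P (cyl 0 (fun=> F0)) = 1%E.
Proof.
have [_ <- _] := mX; congr (P _).
by apply/seteqP; split=> w /= h => [|j]; [exact: h|rewrite leqn0 => /eqP ->].
Qed.

Lemma prob_cylS k s F :
  P (cyl k.+1 (upd s k.+1 F)) = (P (cyl k s) * (t (s k) F)%:E)%E.
Proof.
have [_ _ /(_ k (upd s k.+1 F)) h] := mX.
rewrite [LHS]h updE {2}/upd ltn_eqF //; congr (P _ * _)%E.
by apply/seteqP; split=> w /= h' j jk; rewrite h' // /upd ltn_eqF.
Qed.

Lemma cyl_ae k s (Q : Omega -> Prop) : {ae P, forall w, Q w} ->
  (0 < P (cyl k s))%E -> exists2 w, cyl k s w & Q w.
Proof.
move=> [N [mN N0 QN]] Pc; apply: contrapT => nex.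
suff : (P (cyl k s) <= 0)%E by rewrite leNgt Pc.
rewrite -N0; apply: le_measure; rewrite ?inE //; first exact: measurable_cyl.
by move=> w cw; apply: QN => /= Qw; apply: nex; exists w.
Qed.

Lemma prob_bigsetU_le (I : Type) (r : seq I) (A : I -> set Omega) :
  (forall i, measurable (A i)) ->
  (P (\big[setU/set0]_(i <- r) A i) <= \sum_(i <- r) P (A i))%E.
Proof.
move=> mA; elim: r => [|i r IH]; first by rewrite !big_nil measure0.
rewrite !big_cons (le_trans (measureU2 _ _ _)) ?leeD2l //.
exact: bigsetU_measurable.
Qed.

Variable c : S -> S -> motion R.
Variable V : S -> motion R -> bool.

Fixpoint track (x : nat -> S) k : motion R :=
  if k is m.+1 then mmul (c (x m) (x m.+1)) (track x m) else mone.

(** The paths that follow [s] up to time [k], have motion [h] then, and stay out of [V] for [N]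
    times from [k] on. The recursion copies that of [survive], which gives [prob_avoid] by
    induction. *)
Fixpoint avoid N k s (h : motion R) : set Omega :=
  if N is M.+1 then
    if V (s k) h then set0 else
    \big[setU/set0]_(K : S) avoid M k.+1 (upd s k.+1 K) (mmul (c (s k) K) h)
  else cyl k s.

Lemma measurable_avoid N k s h : measurable (avoid N k s h).
Proof.
elim: N k s h => [|N IH] k s h /=; first exact: measurable_cyl.
by case: ifP => // _; apply: bigsetU_measurable.
Qed.

Lemma prob_avoid N k s h :
  (P (avoid N k s h) <= P (cyl k s) * (survive t c V N (s k) h)%:E)%E.
Proof.
elim: N k s h => [|N IH] k s h; first by rewrite mule1.
rewrite surviveS /=; case: ifP => _; first by rewrite measure0 mule0.
apply: le_trans (prob_bigsetU_le _ _) _.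
  by move=> K; exact: measurable_avoid.
have [p Pp] : exists p, P (cyl k s) = p%:E.
  by exists (fine (P (cyl k s))); rewrite fineK // fin_num_measure //;
    exact: measurable_cyl.
rewrite Pp -EFinM /avg mulr_sumr -sumEFin; apply: lee_sum => K _.
apply: le_trans (IH _ _ _) _.
by rewrite prob_cylS Pp updE -!EFinM mulrA.
Qed.

Lemma in_avoid N k s h w : cyl k s w -> track (X^~ w) k = h ->
  (forall j, ~~ V (X j w) (track (X^~ w) j)) -> avoid N k s h w.
Proof.
move=> cw th nV; elim: N k s h cw th => [//|N IH] k s h cw th /=.
have sk : s k = X k w by rewrite cw.
rewrite -th sk (negPf (nV k)) -bigcup_seq; exists (X k.+1 w).
  by rewrite /= mem_index_enum.
by apply: IH => //; apply/cyl_upd.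
Qed.

(** A path from [F0] that misses [V] forever lies in all the events [avoid N], whose probabilities
    are at most the survival probabilities. *)
Lemma ae_hits : (forall y : R, 0 < y -> exists N, survive t c V N F0 mone <= y) ->
  {ae P, forall w, X 0%N w = F0 -> exists j, V (X j w) (track (X^~ w) j)}.
Proof.
move=> small; exists (\bigcap_N avoid N 0%N (fun=> F0) mone); split.
- by apply: bigcapT_measurable => N; exact: measurable_avoid.
- apply/eqP; rewrite eq_le measure_ge0 andbT; apply/lee_addgt0Pr => y y0.
  rewrite add0e; have [N Ny] := small y y0.
  apply: (@le_trans _ _ (P (avoid N 0%N (fun=> F0) mone))).
    apply: le_measure; rewrite ?inE; [|exact: measurable_avoid|].
      by apply: bigcapT_measurable => M; exact: measurable_avoid.
    by move=> w; apply.
  apply: le_trans (prob_avoid _ _ _ _) _.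
  by rewrite prob_cyl0 mul1e lee_fin.
move=> w /= /not_implyP[X0 nV] N _; apply: in_avoid => //.
  by move=> j; rewrite leqn0 => /eqP ->.
by move=> j; apply/negP => Vj; apply: nV; exists j.
Qed.

End Cylinders.

(** * The rolling process as a walk on faces and motions *)

Section RollingProcess.
Variables (R : realType) (n : nat) (v : 'M[R]_(n, 3)) (F0 : facet v).
Variables (t : facet v -> facet v -> R) (d : measure_display).
Variables (Omega : measurableType d) (P : probability Omega R).
Variable Y : nat -> Omega -> config v.
Hypothesis pv : is_polytope3 v.
Hypothesis rv : resting v (val F0).
Hypothesis rt : reversible_transition t.
Hypothesis pY : rolling_process F0 t P Y.
Implicit Types (F K : facet v) (s : config v) (g h : motion R).

Let X k w := (Y k w).2.
Let good w := Y 0%N w = (v, F0) /\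
  forall k, Y k.+1 w = Y k w \/ rolls (Y k w) (Y k.+1 w).

Lemma transition_ge0 F K : 0 <= t F K.
Proof.
have [tpos t0 tdiag _] := rt.
have [<-|FK] := eqVneq F K; first by have [] := tdiag F.
by case: (boolP (adj F K)) => [/tpos/ltW|/t0 ->].
Qed.

Lemma adjxx F : adj F F = false.
Proof. by rewrite /adj eqxx. Qed.

Lemma transition_sum F : \sum_K t F K = 1.
Proof.
have [_ t0 tdiag _] := rt.
rewrite (bigD1 F) //= (tdiag F).1.
suff -> : \sum_(K | K != F) t F K = \sum_(K | adj F K) t F K by rewrite subrK.
rewrite (bigID (adj F)) /= [X in _ + X]big1 ?addr0 => [|K /andP[KF aFK]].
  apply: eq_bigl => K; case: eqP => [->|] //; by rewrite adjxx.
by rewrite t0 // eq_sym.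
Qed.

Lemma reachable_placed s : reachable F0 s -> placed s.
Proof.
elim=> [|s1 s2 _ p1 r12]; last exact: rolls_placed r12.
by split=> //; exact: congruent_refl.
Qed.

Lemma reachable_cyl s : reachable F0 s -> exists k x,
  [/\ x k = s.2, (0 < P (cyl X k x))%E
    & forall w, good w -> cyl X k x w -> Y k w = s].
Proof.
have [mX _] := pY; have [tpos _ _ _] := rt.
elim=> [|s1 s2 rs1 [k [x [xk Px Yk]]] r12].
  exists 0%N, (fun=> F0); split=> //; first by rewrite (prob_cyl0 mX).
  by move=> w [].
exists k.+1, (upd x k.+1 s2.2); split.
- by rewrite updE.
- by rewrite (prob_cylS mX) mule_gt0 // lte_fin xk tpos // rolls_adj.
move=> w gw /cyl_upd[cw Xw]; have Yw := Yk w gw cw.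
have [_ /(_ k)] := gw; rewrite Yw => -[Yk1|r].
  by move: Xw; rewrite /X Yk1 => e; case: r12; rewrite e eqxx.
exact: rolls_uniq pv (reachable_placed rs1) r r12 Xw.
Qed.

(* The process performs every roll of positive probability, so all these rolls
   exist. *)
Lemma roll_exists s K : reachable F0 s -> adj s.2 K ->
  exists2 s', rolls s s' & s'.2 = K.
Proof.
have [mX gY] := pY; have [tpos _ _ _] := rt.
move=> rs aK; have [k [x [xk Px Yk]]] := reachable_cyl rs.
have : (0 < P (cyl X k.+1 (upd x k.+1 K)))%E.
  by rewrite (prob_cylS mX) mule_gt0 // lte_fin xk tpos.
move=> /(cyl_ae mX gY)[w /cyl_upd[cw Xw] gw].
exists (Y k.+1 w) => //; have [_ /(_ k)] := gw; rewrite (Yk w gw cw) => -[] // e.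
by move: aK; rewrite -Xw /X e adjxx.
Qed.

Definition reached F := exists p, reachable F0 (p, F).

(** The reference at [F0] is the initial position, so the walk starts at [mone]. Faces never reached
    receive the default [v]. *)
Lemma reference_positions : exists ref : facet v -> 'M[R]_(n, 3),
  ref F0 = v /\ forall F, reached F -> reachable F0 (ref F, F).
Proof.
have /choice[ref refP] : forall F, exists p,
    (F = F0 -> p = v) /\ (reached F -> reachable F0 (p, F)).
  move=> F; have [->|FF0] := eqVneq F F0.
    by exists v; split=> // _; exact: reachable_init.
  have [[p rp]|nr] := pselect (reached F).
    by exists p; split=> // /eqP; rewrite (negPf FF0).
  by exists v; split=> // /eqP; rewrite (negPf FF0).
by exists ref; split=> [|F]; [exact: (refP F0).1|exact: (refP F).2].
Qed.

Variable ref : facet v -> 'M[R]_(n, 3).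
Hypothesis ref0 : ref F0 = v.
Hypothesis refP : forall F, reached F -> reachable F0 (ref F, F).

Definition linked F K := reached F /\ adj F K.

Lemma linked_sym F K : linked F K -> linked K F.
Proof.
move=> [rF aFK]; split; last by rewrite adj_sym.
have [[p K'] rs /= KK'] := roll_exists (refP rF) aFK.
by exists p; rewrite -KK'; exact: reachable_roll (refP rF) rs.
Qed.

(** [c F K] carries the reference position on [K] to the result of rolling the one on [F]. The value
    [mone] elsewhere keeps [c] rigid and reversible on all pairs, and describes staying when
    [F = K]. *)
Lemma roll_motions : exists c : facet v -> facet v -> motion R, forall F K,
  [/\ direct (c F K),
      linked F K -> rolls (ref F, F) (act (ref K) (c F K), K)
    & ~ linked F K -> c F K = mone].
Proof.
have /choice[c cP] : forall FK, exists g, [/\ direct g,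
    linked FK.1 FK.2 -> rolls (ref FK.1, FK.1) (act (ref FK.2) g, FK.2)
    & ~ linked FK.1 FK.2 -> g = mone].
  move=> [F K] /=.
  have [lFK|nl] := pselect (linked F K); last first.
    by exists mone; split=> //; exact: direct1.
  have [rF aFK] := lFK; have [s' rs' s'K] := roll_exists (refP rF) aFK.
  have ps' := rolls_placed (reachable_placed (refP rF)) rs'.
  have pK := reachable_placed (refP (linked_sym lFK).1).
  have [g dg s'E] := placed_motion pv pK ps' (esym s'K).
  by exists g; split=> //= _; rewrite -s'E.
by exists (fun F K => c (F, K)) => F K; exact: (cP (F, K)).
Qed.

Variable c : facet v -> facet v -> motion R.
Hypothesis cP : forall F K,
  [/\ direct (c F K),
      linked F K -> rolls (ref F, F) (act (ref K) (c F K), K)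
    & ~ linked F K -> c F K = mone].

Lemma c_direct F K : direct (c F K).
Proof. by have [] := cP F K. Qed.

Lemma c_rigid F K : rigid (c F K).
Proof. by have /andP[] := c_direct F K. Qed.

Lemma c_rolls F K : linked F K -> rolls (ref F, F) (act (ref K) (c F K), K).
Proof. by have [_ h _] := cP F K. Qed.

(** Undo the roll from [F] to [K] and move the result by the inverse of [c F K]: this is a roll from
    the reference on [K]. It is unique, and motions act freely. *)
Lemma c_rev F K : c K F = minv (c F K).
Proof.
have [lFK|nl] := pselect (linked F K); last first.
  have [_ _ ->] := cP F K => //; have [_ _ ->] := cP K F; rewrite ?minv1 //.
  by move=> /linked_sym.
have lKF := linked_sym lFK.
have pF := reachable_placed (refP lFK.1); have pK := reachable_placed (refP lKF.1).
have := rolls_act (directV (c_direct F K)) (rolls_sym pF.2 (c_rolls lFK)).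
rewrite /= -actM mmulmV ?c_rigid // act1 => r.
have [] := rolls_uniq pv pK (c_rolls lKF) r erefl.
by move=> /(act_free pF); apply; [exact: c_direct|exact/directV/c_direct].
Qed.

(** Rolls commute with planar motions, so a roll from a moved reference position is the moved
    roll. *)
Lemma rolls_ref F K g s : reached F -> direct g ->
  rolls (act (ref F) g, F) s -> s.2 = K ->
  s.1 = act (ref K) (mmul (c F K) g).
Proof.
move=> rF dg r sK.
have lFK : linked F K by split=> //; rewrite -sK; exact: (rolls_adj r).
have pF := reachable_placed (refP rF).
have r' := rolls_act dg (c_rolls lFK); rewrite /= -actM in r'.
by rewrite (rolls_uniq pv (placed_act dg pF) r r').
Qed.

Local Notation avgn k f := (iter k (avg t c) f).

(** Keep only one path in the average; [x] is the product of its transition probabilities. Starting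
    at [g] shifts its end by [g], so the bound is uniform in [g]. *)
Lemma reachable_avg s : reachable F0 s -> exists h k, exists2 x : R, 0 < x &
  [/\ direct h, s.1 = act (ref s.2) h
    & forall f g, (forall F g, rigid g -> 0 <= f F g) -> rigid g ->
      x * f s.2 (mmul h g) <= avgn k f F0 g].
Proof.
have [tpos _ _ _] := rt.
elim=> [|s1 s2 rs1 [h [k [x x0 [dh s1E hx]]]] r12].
  exists mone, 0%N, 1 => //; rewrite /= ref0 act1; split=> //; first exact: direct1.
  by move=> f g _ _; rewrite mmul1m mul1r.
have rF : reached s1.2 by exists s1.1; case: (s1) rs1.
have s2E : s2.1 = act (ref s2.2) (mmul (c s1.2 s2.2) h).
  by apply: rolls_ref => //; rewrite -s1E; case: (s1) r12.
have t0 := tpos _ _ (rolls_adj r12).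
exists (mmul (c s1.2 s2.2) h), k.+1, (x * t s1.2 s2.2); first exact: mulr_gt0.
split=> //; first exact: directM (c_direct _ _) dh.
move=> f g f0 rg; rewrite iterSr.
have af0 F g' : rigid g' -> 0 <= avg t c f F g'.
  move=> rg'; apply: sumr_ge0 => K _.
  by rewrite mulr_ge0 ?transition_ge0 // f0 // rigidM // c_rigid.
apply: le_trans (hx _ _ af0 rg); rewrite -mulrA ler_wpM2l ?(ltW x0) //.
rewrite /avg (bigD1 s2.2) //= mmulA lerDl; apply: sumr_ge0 => K _.
have rh : rigid h by case/andP: dh.
by rewrite mulr_ge0 ?transition_ge0 // f0 // !rigidM // c_rigid.
Qed.

Lemma track_position w : good w -> forall k,
  [/\ reachable F0 (Y k w), direct (track c (X^~ w) k)
    & (Y k w).1 = act (ref (X k w)) (track c (X^~ w) k)].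
Proof.
move=> [Y0 YS]; elim=> [|k [rk dk Yk]].
  rewrite /X Y0 /= ref0 act1; split=> //; [exact: reachable_init|exact: direct1].
have rX : reached (X k w) by exists (Y k w).1; rewrite /X; case: (Y k w) rk.
have dS : direct (track c (X^~ w) k.+1) by exact: directM (c_direct _ _) dk.
case: (YS k) => [e|r].
  split=> //; first by rewrite e.
  (* No motion corresponds to the factor [c F F = mone]. *)
  have -> : track c (X^~ w) k.+1 = track c (X^~ w) k.
    rewrite /= {1 2}/X e; have [_ _ ->] := cP (Y k w).2 (Y k w).2;
      first by rewrite mmul1m.
    by move=> [_]; rewrite adjxx.
  by rewrite /X e.
split=> //; first exact: reachable_roll rk r.
apply: rolls_ref => //; rewrite -Yk /X; move: r; by case: (Y k w).
Qed.

Lemma open_near (U : set 'rV[R]_2) y : open U -> U y ->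
  exists2 e : R, 0 < e & forall g, near_id e g -> U (y *m g.1 + g.2).
Proof.
move=> oU Uy; have /nbhs_ballP[e e0 eU] : nbhs y U by exact: open_nbhs_nbhs.
(* Each coordinate of [y] moves by at most [M] times the tolerance, the summand 1 accounting for the
   translation. *)
pose M := \sum_i `|y 0 i| + 1.
have M0 : 0 < M by rewrite ltr_wpDl // sumr_ge0.
exists (e / 2 / M); first by rewrite !divr_gt0.
move=> g /near_idP[gA gb]; apply: eU; split=> // i j; rewrite ord1 /ball /=.
rewrite !mxE (_ : y 0 j - _ = - (\sum_k y 0 k * (g.1 k j - (k == j)%:R) + g.2 0 j)).
  rewrite normrN (@le_lt_trans _ _ (e / 2)) //; last first.
    by rewrite ltr_pdivrMr // mulr_natr mulr2n ltrDl.
  apply: le_trans (ler_normD _ _) _.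
  rewrite [leRHS](_ : _ = (\sum_k `|y 0 k|) * (e / 2 / M) + e / 2 / M); last first.
    by rewrite /M; field; rewrite gt_eqF.
  rewrite lerD // (le_trans (ler_norm_sum _ _ _)) // mulr_suml ler_sum // => k _.
  by rewrite normrM ler_wpM2l.
have -> : \sum_k y 0 k * (g.1 k j - (k == j)%:R) = \sum_k y 0 k * g.1 k j - y 0 j.
  under eq_bigr do rewrite mulrBr.
  rewrite sumrB; congr (_ - _); rewrite (bigD1 j) //= eqxx mulr1.
  rewrite big1 ?addr0 // => k /negPf ->.
  by rewrite mulr0.
ring.
Qed.

Lemma ae_vertex_in (U : set 'rV[R]_2) y : open U -> U y -> trace F0 y ->
  {ae P, forall w, exists k z, U z /\ has_vertex_at (Y k w).1 z}.
Proof.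
move=> oU Uy [s [rs [i si]]].
have [mX gY] := pY; have [_ _ _ [pi [pi0 trev]]] := rt.
have [h [k [x x0 [dh sE hx]]]] := reachable_avg rs.
pose V F g := `[< exists z, U z /\ has_vertex_at (act (ref F) g) z >].
have [e e0 eU] := open_near oU Uy.
(* Among the times [0, ..., k], only the visit at time [k] is used. *)
have Vnear g : rigid g -> near_id e g -> survive t c V k.+1 F0 g <= 1 - x.
  move=> rg eg; have Vg : V s.2 (mmul h g).
    apply/asboolP; exists (y *m g.1 + g.2); split; first exact: eU.
    by exists i; rewrite actM -sE row_act si mv_plane.
  have surv1 F g' : survive t c V 1 F g' = 1 - (V F g')%:R.
    rewrite surviveS; case: ifP => _; rewrite ?subrr // subr0.
    by rewrite /avg; under eq_bigr do rewrite mulr1; exact: transition_sum.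
  have -> : survive t c V k.+1 F0 g = iter k (stay t c V) (survive t c V 1) F0 g.
    by rewrite /survive -addn1 iterD.
  apply: (@le_trans _ _ (avgn k (survive t c V 1) F0 g)).
    apply: iter_stay_avgn => //; [exact: transition_ge0|exact: c_rigid|].
    by move=> F g' _; rewrite surv1 subr_ge0; case: (V F g'); rewrite ?ler01.
  have -> : avgn k (survive t c V 1) F0 g = 1 - avgn k (fun F g' => (V F g')%:R) F0 g.
    have := avgnB t c k (fun _ _ => 1) (fun F g' => (V F g')%:R) F0 g.
    rewrite (avgn_cst c transition_sum) => <-.
    congr (iter _ _ _ _ _); apply/funext => F; apply/funext => g'.
    exact: surv1.
  have := hx (fun F g' => (V F g')%:R) g _ rg; rewrite Vg mulr1 => xV.
  by rewrite lerD2l lerN2 xV.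
have small := survive_vanishes transition_ge0 transition_sum pi0 trev c_rigid
  c_rev e0 x0 Vnear.
have hits := ae_hits mX small.
apply: filterS2 hits gY => w hw gw.
have [j /asboolP[z [Uz Vz]]] : exists j, V (X j w) (track c (X^~ w) j).
  by apply: hw; have [-> _] := gw.
by exists j, z; split=> //; have [_ _ ->] := track_position gw j.
Qed.

End RollingProcess.

(** * Countable reduction and density *)

Lemma rational_ball (R : realType) (O : set 'rV[R]_2) : open O -> O !=set0 ->
  exists i : rat * rat * nat, let B := ball (\row_(j < 2)
    ratr (if j == 0 then i.1.1 else i.1.2) : 'rV[R]_2) i.2.+1%:R^-1 in
    B `<=` O.
Proof.
move=> oO [x Ox]; have /nbhs_ballP[e /= e0 eO] : nbhs x O by exact: open_nbhs_nbhs.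
(* Half of [e] for approximating the centre, half for the radius. *)
have e2 : 0 < e / 2 by rewrite divr_gt0.
have [m _ /(_ m (leqnn m)) /= me] := near_infty_natSinv_lt (PosNum e2).
have near_rat (z : R) : exists q : rat, `|ratr q - z| < m.+1%:R^-1.
  have [q] : exists q : rat, ratr q \in `]z - m.+1%:R^-1, z + m.+1%:R^-1[.
    by apply: rat_in_itvoo; rewrite ltrD2l gtrN // invr_gt0.
  by rewrite in_itv /= => /andP[q1 q2]; exists q; rewrite ltr_distl q1 q2.
have [a ha] := near_rat (x 0 0); have [b hb] := near_rat (x 0 1).
exists (a, b, m) => /= y [_ hy]; apply: eO; split=> // i j.
rewrite ord1; have := hy 0 j; rewrite /ball /= !mxE => hyj.
apply: (@lt_trans _ _ (m.+1%:R^-1 + m.+1%:R^-1)); last by rewrite (splitr e) ltrD.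
set q : R := ratr _ in hyj; rewrite -(subrKA q) (le_lt_trans (ler_normD _ _)) //.
rewrite ltrD // distrC /q.
by case: (ord2P j) => ->.
Qed.

Theorem theorem1p5 (R : realType) (n : nat) (v : 'M[R]_(n, 3)) (F0 : facet v)
    (t : facet v -> facet v -> R) (d : measure_display)
    (Omega : measurableType d) (P : probability Omega R)
    (Y : nat -> Omega -> config v) :
  is_polytope3 v ->
  resting v (val F0) ->
  dense (trace F0) ->
  reversible_transition t ->
  rolling_process F0 t P Y ->
  {ae P, forall w, dense [set y : 'rV[R]_2 | exists k, has_vertex_at (Y k w).1 y]}.
Proof.
move=> pv rv dT rt pY.
pose B (i : rat * rat * nat) : set 'rV[R]_2 :=
  (ball (\row_(j < 2) ratr (if j == 0 then i.1.1 else i.1.2) : 'rV[R]_2)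
     i.2.+1%:R^-1)°.
have [ref [ref0 refP]] := reference_positions F0.
have [c cP] := roll_motions pv rv rt pY refP.
have aeB i : {ae P, forall w, exists k z, B i z /\ has_vertex_at (Y k w).1 z}.
  have oB : open (B i) by exact: open_interior.
  have [|y [By Ty]] := dT (B i) _ oB.
    eexists; apply: nbhsx_ballx; by rewrite invr_gt0.
  exact: (ae_vertex_in pv rv rt pY ref0 refP cP oB By Ty).
(* The triples are enumerated by natural numbers, to intersect countably many almost sure events. *)
have : {ae P, forall w, forall m i, unpickle m = Some i ->
    exists k z, B i z /\ has_vertex_at (Y k w).1 z}.
  apply: ae_foralln => m; case E : (unpickle m) => [i|].
    by apply: filterS (aeB i) => w hw j [<-].
  by apply: (@filterS _ _ _ setT) filterT => w _.
apply: filterS => w hw O O0 oO.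
have [i BO] := rational_ball oO O0.
have [k [z [Bz Vz]]] := hw (pickle i) i (pickleK i).
exists z; split; last by exists k.
exact: BO (interior_subset Bz).
Qed.
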